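(* There exists a linear-time algorithm whose input is a graph $G$ that does not contain a cycle with a unique chord and whose output is a maximum clique of $G$.
   Context: All graphs are finite and simple. Linear time means time $\mathcal{O}(n+m)$, where $n$ and $m$ are the numbers of nodes and edges of the input graph. A cycle in $G$ is a sequence of nodes $v_1v_2\ldots v_kv_1$ ($k\ge3$), distinct except for the first and last, with consecutive nodes adjacent; an edge of $G$ with both ends in the cycle that is not an edge of the cycle is a chord. $G$ does not contain a cycle with a unique chord if no cycle of $G$ has exactly one chord. *)

(* Defs.v *)
From mathcomp Require Import all_boot.
Set Implicit Arguments.
Unset Strict Implicit.
Unset Printing Implicit Defensive.

Record sgraph (T : finType) := SGraph {
  adj :> rel T;
  sgraph_sym : symmetric adj;
  sgraph_irrefl : irreflexive adj
}.

Section Graphs.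
Variables (T : finType) (G : sgraph T).

(* Edges are unordered pairs. *)
Definition edges : {set {set T}} :=
  [set [set p.1; p.2] | p : T * T & G p.1 p.2].

(* The sequence [:: v_1; ...; v_k] stands for the closed walk v_1 ... v_k v_1. *)
Definition is_cycle (c : seq T) : bool :=
  [&& 2 < size c, uniq c & cycle G c].

Definition cycle_edges (c : seq T) : {set {set T}} :=
  [set [set x; next c x] | x in c].

Definition chords (c : seq T) : {set {set T}} :=
  [set E in edges | E \subset c] :\: cycle_edges c.

Definition no_cycle_with_unique_chord : Prop :=
  forall c : seq T, is_cycle c -> #|chords c| <> 1.

Definition clique (K : {set T}) : Prop :=
  {in K &, forall x y, x != y -> G x y}.

Definition maximum_clique (K : {set T}) : Prop :=
  clique K /\ forall K' : {set T}, clique K' -> #|K'| <= #|K|.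

End Graphs.

(* Random access machine with the instruction set of Cook and Reckhow (Time
   bounded random access machines, 1973), over natural numbers with truncated
   subtraction.  X_i denotes the content of register i; each instruction
   counts for one unit of time. *)
Inductive instr :=
| IConst of nat & nat          (* X_i := k *)
| IAdd of nat & nat & nat      (* X_i := X_j + X_k *)
| ISub of nat & nat & nat      (* X_i := X_j - X_k *)
| ILoad of nat & nat           (* X_i := X_(X_j) *)
| IStore of nat & nat          (* X_(X_i) := X_j *)
| IJumpPos of nat & nat        (* if X_i > 0 then go to instruction l *)
| IRead of nat                 (* X_i := next input word, 0 if none is left *)
| IWrite of nat                (* append X_i to the output *)
| IHalt.

Definition program := seq instr.

Record state := State {
  pc : nat;
  regs : nat -> nat;
  input : seq nat;
  output : seq nat
}.

Definition init (w : seq nat) : state := State 0 (fun=> 0) w [::].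

(* Running past the end of the program halts. *)
Definition fetch (P : program) (s : state) : instr := nth IHalt P (pc s).

Definition set_reg (s : state) (i v : nat) : state :=
  State (pc s).+1 (fun a => if a == i then v else regs s a) (input s) (output s).

Definition step (P : program) (s : state) : state :=
  let X := regs s in
  match fetch P s with
  | IConst i k => set_reg s i k
  | IAdd i j k => set_reg s i (X j + X k)
  | ISub i j k => set_reg s i (X j - X k)
  | ILoad i j => set_reg s i (X (X j))
  | IStore i j => set_reg s (X i) (X j)
  | IJumpPos i l =>
      State (if 0 < X i then l else (pc s).+1) X (input s) (output s)
  | IRead i =>
      set_reg (State (pc s) X (behead (input s)) (output s)) i
              (head 0 (input s))
  | IWrite i => State (pc s).+1 X (input s) (rcons (output s) (X i))
  | IHalt => s
  end.

Definition halted (P : program) (s : state) : bool :=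
  if fetch P s is IHalt then true else false.

Definition run (P : program) (w : seq nat) (t : nat) : state :=
  iter t (step P) (init w).

(* On input w, P halts with output r after at most T steps, no register ever
   containing a number above B. *)
Definition computes_within (T B : nat) (P : program) (w r : seq nat) : Prop :=
  exists2 t, t <= T &
    [/\ halted P (run P w t),
        output (run P w t) = r &
        forall i a, i <= t -> regs (run P w i) a <= B].

(* L v lists the neighbours of v without repetition, in an arbitrary order. *)
Definition adjacency_lists n (G : sgraph 'I_n) (L : 'I_n -> seq 'I_n) : Prop :=
  forall v, uniq (L v) /\ L v =i G v.

(* n, followed for v = 0, ..., n-1 by the degree and the neighbours of v. *)
Definition encode n (L : 'I_n -> seq 'I_n) : seq nat :=
  n :: flatten [seq size (L v) :: [seq val u | u <- L v] | v <- enum 'I_n].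

(* P runs in time O(n + m) with words of O(log (n + m)) bits on every
   adjacency-list representation of every graph satisfying Pre, and its output
   satisfies Post.  The additive constants only account for tiny graphs
   (n + m <= 1), in particular the one without nodes. *)
Definition linear_time_algorithm (P : program)
    (Pre : forall n, sgraph 'I_n -> Prop)
    (Post : forall n, sgraph 'I_n -> seq nat -> Prop) : Prop :=
  exists c : nat, forall n (G : sgraph 'I_n) (L : 'I_n -> seq 'I_n),
    Pre n G -> adjacency_lists G L ->
    let N := n + #|edges G| in
    exists2 r, computes_within (c * N.+1) (N.+2 ^ c) P (encode L) r & Post n G r.

Definition lists_set n (r : seq nat) (K : {set 'I_n}) : Prop :=
  perm_eq r [seq val x | x <- enum K].

(* Main.v *)
Require Import Defs.
From mathcomp Require Import all_boot zify.
Set Implicit Arguments.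
Unset Strict Implicit.
Unset Printing Implicit Defensive.

(* In a graph without a cycle with a unique chord, a maximal clique K with at
   least three vertices is isolated: no path outside K joins two of its vertices,
   since a shortest one would close up, through a third vertex of K, to a cycle
   with a unique chord.  In particular the graph is diamond-free.  Search the
   graph, marking all unmarked neighbours of a vertex as its children when it is
   explored.  The explored ancestors of two marked unexplored vertices are
   connected, so when the first vertex r of an isolated clique K is explored, no
   other vertex of K is marked, and all of K - r become children of r.  Hence a
   largest set consisting of a vertex v, its parent and those neighbours of v
   that have the same parent is a maximum clique. *)

(** * Structure and search *)

(** Correctness splits in two: diamond-freeness makes every candidate set a clique, and isolation
    makes some candidate contain a maximum clique. Isolation needs a third vertex of the clique, so
    cliques with at most two vertices are handled apart: a non-root and its parent already form a
    candidate of size two. The search need not be depth-first in the strict sense. It only has to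
    finish everything reachable from marked vertices before it opens a new root, and a stack whose
    bottom holds all vertices does this: an unmarked vertex is popped only when no marked one is
    left unexplored. A candidate is recognised by comparing marks across each edge, in constant
    time, and each vertex is popped at most twice; hence linear time. On the machine, jumps are
    confined to a small structured language whose compiler is proved correct once. Its semantics
    counts instructions and checks word sizes, so that one total-correctness argument yields output,
    time and word bound. Both bounds are expressed by [off n], the end of the memory in use, which
    is linear in the number of nodes and edges. *)

Section Structure.
Variables (T : finType) (G : sgraph T).

Let symG x y : G x y -> G y x.
Proof. by rewrite sgraph_sym. Qed.

(** The default value covers the wrap-around: at [i = size t] the right-hand side is [c], the head
    to which the cycle returns. *)
Lemma next_cons_nth (c : T) (t : seq T) i : uniq (c :: t) -> i <= size t ->
  next (c :: t) (nth c (c :: t) i) = nth c t i.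
Proof. by move=> ut le_i; rewrite next_nth mem_nth // index_uniq. Qed.

(* The cycle c, f 0, ..., f N has f 0 -- f N as its only chord. *)
Lemma unique_chord_cycle (c : T) (f : nat -> T) N : 1 < N ->
  (forall i j, i < j <= N -> f i != f j) -> (forall i, i <= N -> c != f i) ->
  G c (f 0) -> G c (f N) -> (forall i, 0 < i < N -> ~~ G c (f i)) ->
  (forall i, i < N -> G (f i) (f i.+1)) -> G (f 0) (f N) ->
  (forall i j, i.+1 < j <= N -> G (f i) (f j) -> i = 0 /\ j = N) ->
  ~ no_cycle_with_unique_chord G.
Proof.
move=> gt1 inj cf Gc0 GcN Gci Gf G0N chordless.
(* The sigma type keeps [t] opaque, so that simplification does not unfold [mkseq]. *)
have [t et] : {t | t = mkseq f N.+1} by exists (mkseq f N.+1).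
have st : size t = N.+1 by rewrite et size_mkseq.
have nt i : i <= N -> nth c t i = f i by move=> le_i; rewrite et nth_mkseq.
set w := c :: t; have nw i : i <= N -> nth c w i.+1 = f i by apply: nt.
have sw : size w = N.+2 by rewrite /= st.
have uw : uniq w.
  rewrite /= et; apply/andP; split.
    by apply/mapP=> -[i]; rewrite mem_iota => /cf/eqP.
  apply/mkseq_uniqP.
  move=> i j; rewrite !inE => lt_i lt_j e.
  case: (ltngtP i j) => // lt.
    by have := inj i j ltac:(lia); rewrite e eqxx.
  by have := inj j i ltac:(lia); rewrite e eqxx.
(* Position 0 of [w] holds [c] and position [i.+1] holds [f i], so the successor of position [i] is
   [f i], except at the last position, where the cycle closes at [c]. *)
have nextw i : i <= N.+1 -> next w (nth c w i) = if i < N.+1 then f i else c.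
  move=> le_i; rewrite next_cons_nth ?st //.
  by case: ltnP => lt_i; [apply: nt | rewrite nth_default ?st].
have fw i : i <= N -> f i \in w by move=> le_i; rewrite -nw // mem_nth // sw.
move/(_ w); case.
  rewrite /is_cycle sw uw !ltnS ltnW //= rcons_path; apply/andP; split; last first.
    by rewrite et mkseqS last_rcons sgraph_sym.
  apply/(pathP c) => i; rewrite st => lt_i; rewrite nt //.
  by case: i lt_i => [|i] lt_i //=; rewrite nt ?Gf // ltnW.
rewrite (_ : chords G w = [set [set f 0; f N]]) ?cards1 //.
apply/setP=> E; rewrite !inE; apply/idP/eqP => [/and3P[nE] |->]; last first.
  apply/and3P; split.
  - apply/imsetP=> -[x]; case/(nthP c)=> i; rewrite sw ltnS => le_i <-.
    rewrite nextw //; case: i le_i => [|i] le_i e.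
      by have := set21 c (f 0); rewrite -[nth _ _ _]/c in e; rewrite -e !inE
        !(negPf (cf _ _)).
    move: e; rewrite nw //; case: ltnP => lt_i e; last first.
      by have := set22 (f i) c; rewrite -e !inE !(negPf (cf _ _)).
    have h1 := set21 (f i) (f i.+1); have h2 := set22 (f i) (f i.+1).
    have h3 := set22 (f 0) (f N); rewrite -!e in h1 h2; rewrite e in h3.
    move: h2; rewrite !inE eq_sym (negPf (inj 0 i.+1 _)); last by lia.
    case: (ltngtP i.+1 N) => [lt|lt|eqN] /=; [|lia|].
      by rewrite (negPf (inj i.+1 N _)) //; lia.
    move: h1; rewrite !inE eq_sym (negPf (inj 0 i _)); last by lia.
    by rewrite (negPf (inj i N _)) //; lia.
  - by apply/imsetP; exists (f 0, f N) => //; rewrite inE.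
  - by apply/subsetP=> x; rewrite !inE => /orP[]/eqP->; apply: fw.
move=> /imsetP[[x y]]; rewrite inE /= => Gxy eE.
move=> /subsetP sEw; have wx : x \in w by apply: sEw; rewrite eE set21.
have wy : y \in w by apply: sEw; rewrite eE set22.
clear sEw.
have [i le_i ex] := nthP c wx; have [j le_j ey] := nthP c wy.
rewrite sw !ltnS in le_i le_j.
wlog lt_ij : x y i j Gxy eE wx wy le_i le_j ex ey / i < j.
  move=> W; case: (ltngtP i j) => [lt|lt|e]; first exact: (W x y i j).
    by apply: (W y x j i) => //; [rewrite sgraph_sym | rewrite setUC].
  by move: Gxy; rewrite -ex -ey e sgraph_irrefl.
have nn x' y' : x' \in w -> E = [set x'; y'] -> next w x' <> y'.
  move=> wx' eE' e; move/negP: nE; apply; apply/imsetP.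
  by exists x' => //; rewrite e.
have := nextw i le_i; rewrite ex => nx.
have := nextw j le_j; rewrite ey => ny.
case: i => [|i] in le_i ex lt_ij nx.
  rewrite -[nth _ _ _]/c in ex; subst x.
  case: j => // j in le_j ey lt_ij ny; rewrite nw // in ey; subst y.
  case: (posnP j) => [j0|gt0]; first by case: (nn _ _ wx eE); rewrite nx j0.
  move: le_j; rewrite ltnS leq_eqVlt => /orP[/eqP jN|lt_j].
    case: (nn (f j) c wy); last by rewrite ny jN ltnn.
    by rewrite setUC.
  by move: (Gci j); rewrite Gxy gt0 lt_j => /(_ isT).
case: j => // j in le_j ey lt_ij ny; rewrite !nw // in ex ey; subst x y.
move: nx; rewrite ifT; last by lia.
move=> nx; case: (ltngtP i.+1 j) => [lt|lt|e]; [|lia|].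
  by rewrite eE; have [|-> ->] := chordless i j _ Gxy; first lia.
by case: (nn _ _ wx eE); rewrite nx e.
Qed.

Hypothesis hG : no_cycle_with_unique_chord G.

(** Otherwise the four-cycle [w x u y] would have the edge between [x] and [y] as its only chord. *)
Lemma diamond_free x y u w : G x y -> G u x -> G u y -> G w x -> G w y ->
  u != w -> G u w.
Proof.
move=> Gxy Gux Guy Gwx Gwy ne_uw; apply/negPn/negP=> nG.
have ne v1 v2 : G v1 v2 -> v1 != v2.
  by move=> h; apply: contraTneq h => ->; rewrite sgraph_irrefl.
pose f i := if i is 0 then x else if i is 1 then u else y.
apply: (@unique_chord_cycle w f 2) => //.
- by move=> [|[|i]] [|[|[|j]]] //= lt; first [by apply: ne; auto | lia].
- by move=> [|[|[|i]]] //= lt; first [by apply: ne | by rewrite eq_sym | lia].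
- by move=> [|[|i]] //= lt; first [by apply: contra nG => /symG | lia].
- by move=> [|[|i]] //= lt; first [by apply: symG | lia].
by move=> [|i] [|[|[|j]]] // lt; lia.
Qed.

(** * Cliques isolated in the rest of the graph *)

Definition within (A : {set T}) : rel T :=
  fun x y => [&& G x y, x \in A & y \in A].

Lemma within_sym A : connect_sym (within A).
Proof.
by apply: sym_connect_sym => x y; rewrite /within sgraph_sym [(x \in A) && _]andbC.
Qed.

Lemma connect_within (A B : {set T}) : A \subset B ->
  subrel (connect (within A)) (connect (within B)).
Proof.
move=> sAB; apply: connect_sub => x y /and3P[Gxy Ax Ay]; apply: connect1.
by rewrite /within Gxy !(subsetP sAB).
Qed.

(** Since [connect] is reflexive, the case [p = q] also forbids a vertex outside [K] with two
    neighbours in [K]. *)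
Definition isolated (K : {set T}) := forall a b p q, a \in K -> b \in K ->
  a != b -> p \notin K -> q \notin K -> G p a -> G q b ->
  ~~ connect (within (~: K)) p q.

(* A shortest path outside K between two vertices of K would, together with
   a third vertex of K, form a cycle with a unique chord. *)
Lemma maximal_clique_isolated (K : {set T}) : clique G K -> 2 < #|K| ->
  (forall x, x \notin K -> exists2 y, y \in K & ~~ G x y) -> isolated K.
Proof.
move=> cK gt2 maxK.
(* By maximality [v] misses some [c] in [K]; if [v] saw both [a] and [b], then [a], [b], [v], [c]
   would form a diamond. *)
have one v a b : v \notin K -> a \in K -> b \in K -> a != b -> G v a -> ~~ G v b.
  move=> nKv Ka Kb ne_ab Gva; apply/negP=> Gvb; have [c Kc nGvc] := maxK v nKv.
  have ne_ca : c != a by apply: contraNneq nGvc => ->.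
  have ne_cb : c != b by apply: contraNneq nGvc => ->.
  move/negP: nGvc; apply.
  apply: (@diamond_free a b) => //; try exact: cK.
  by apply: contraNneq nKv => ->.
have third a b : exists c, [&& c \in K, c != a & c != b].
  apply/existsP; apply: contraLR gt2 => /existsPn h; rewrite -leqNgt.
  apply: leq_trans (_ : #|[set a; b]| <= 2); last by rewrite cards2; case: eqP.
  apply/subset_leq_card/subsetP=> c Kc; move: (h c).
  by rewrite Kc !inE /= negb_and !negbK.
(* Strong induction on the length replaces the choice of a shortest path: every shortcut is a
   shorter walk of the same kind. *)
have nopath : forall N f, 1 < N -> f 0 \in K -> f N \in K -> f 0 != f N ->
    (forall i, i < N -> G (f i) (f i.+1)) ->
    (forall i, 0 < i < N -> f i \notin K) -> False.
  elim/ltn_ind=> N IH f gt1 K0 KN ne0N Gf nK.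
  have nK1 : f 1 \notin K by apply: nK; lia.
  have lastN : G (f N.-1) (f N) by have := Gf N.-1; rewrite prednK ?leqnn //; [apply|]; lia.
  have N3 : 2 < N.
    rewrite ltn_neqAle gt1 andbT; apply/eqP=> eN; rewrite -eN in lastN ne0N KN.
    have /negP[] := one _ _ _ nK1 K0 KN ne0N (symG (Gf 0 (ltnW gt1))).
    exact: lastN.
  (* Any other chord lets the walk jump from [f i] straight to [f j], which shortens it by
     [j - i.+1]. *)
  have chordless i j : i.+1 < j <= N -> G (f i) (f j) -> i = 0 /\ j = N.
    move=> lt_ij Gij; have [/andP[/eqP-> /eqP->] //|nij] := boolP ((i == 0) && (j == N)).
    case: (IH (N - (j - i.+1)) _ (fun k => if k <= i then f k else f (k + (j - i.+1)))).
    - lia.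
    - lia.
    - by [].
    - by rewrite ifN ?subnK //; lia.
    - by rewrite ifN ?subnK //; lia.
    - move=> k lt_k; case: (ltngtP k i) => [lt|lt|->].
      + by apply: Gf; lia.
      + by rewrite addSn; apply: Gf; lia.
      + by rewrite (_ : i.+1 + _ = j) //; lia.
    - by move=> k lt_k; case: ifP => lt; apply: nK; lia.
  have [c /and3P[Kc ne_c0 ne_cN]] := third (f 0) (f N).
  apply: (@unique_chord_cycle c f N) => //.
  (* If [f i = f j] with [0 < i], then [f i.-1] is adjacent to [f j], so [chordless] forces [j = N];
     but [f N] is in [K] and [f i] is not. *)
  - move=> i j lt_ij; apply/eqP=> e.
    case: (posnP i) => [i0|i_gt0].
      case: (ltngtP j N) => [lt|lt|eN]; [|lia|].
        by have /negP := nK j ltac:(lia); rewrite -e i0 K0.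
      by move/negP: ne0N; rewrite -eN -e i0 eqxx.
    have := Gf i.-1; rewrite prednK // e => /(_ ltac:(lia)) Gij.
    have [_ eN] := chordless i.-1 j ltac:(lia) Gij; have /negP := nK i ltac:(lia); by rewrite e eN.
  - move=> i le_i; case: (posnP i) => [->//|i_gt0].
    case: (ltngtP i N) => [lt|lt|->//]; last lia.
    by apply: contraTneq Kc => ->; apply: nK; lia.
  - exact: cK.
  - exact: cK.
  (* The first and the last inner vertex already have a neighbour in [K], which [one] makes unique.
     From any other inner vertex, ending the walk at [c] makes it shorter. *)
  - move=> i lt_i; apply/negP; rewrite sgraph_sym => Gic.
    case: (ltngtP i.+1 N) => [lt|lt|eN]; [|lia|]; last first.
      have /negP[] : ~~ G (f i) c; last by [].
      apply: (one _ (f N)); rewrite ?nK // 1?eq_sym //.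
      by rewrite -eN; apply: Gf; lia.
    case: (posnP i.-1) => [i1|i_gt1].
      have /negP[] : ~~ G (f i) c; last by [].
      apply: (one _ (f 0)); rewrite ?nK // 1?eq_sym //.
      by rewrite sgraph_sym (_ : i = 1) ?Gf //; lia.
    case: (IH i.+1 lt (fun k => if k <= i then f k else c)) => //.
    - lia.
    - by rewrite ltnn.
    - by rewrite ltnn eq_sym.
    - move=> k; rewrite ltnS => le_k; rewrite le_k; case: ltngtP le_k => // [lt_k|->] _.
        by apply: Gf; lia.
      exact: Gic.
    - by move=> k lt_k; rewrite ifT ?nK //; lia.
  - exact: cK.
move=> a b p q Ka Kb ne_ab nKp nKq Gpa Gqb; apply/negP=> /connectP[s ps eq].
have {}ps : path G p s /\ all [predC K] s.
  elim: s p {nKp Gpa eq} ps => //= x s IHs p /andP[/and3P[-> _]].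
  by rewrite !inE => nKx /IHs[-> ->]; rewrite nKx.
case: ps => ps nKs.
(* The default value [b] of [nth] provides the last vertex of the walk. *)
pose f i := nth b (a :: p :: s) i.
have fs i : 0 < i <= (size s).+1 -> f i \notin K.
  case: i => [|[|i]] //= lt_i; apply: (allP nKs).
  by rewrite /f /= mem_nth.
have fl : f (size s).+1 = q by rewrite eq (last_nth b).
have fb : f (size s).+2 = b by rewrite /f nth_default.
apply: (nopath (size s).+2 f) => //; rewrite ?fb //.
move=> i; rewrite ltnS leq_eqVlt => /orP[/eqP->|]; first by rewrite fl fb.
case: i => [|i] lt_i; first exact: symG.
by apply: (pathP b ps).
Qed.

(** * The search and its invariant *)

Section Search.
Variable L : T -> seq T.
Hypothesis adjL : forall v, uniq (L v) /\ L v =i G v.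

Let LE v u : (u \in L v) = G v u.
Proof. by case: (adjL v) => _ ->. Qed.

(* Some None marks the root of a search tree, Some (Some p) a child of p. *)
Definition marking := {ffun T -> option (option T)}.

Definition mark (m : marking) v x : marking :=
  [ffun u => if u == v then Some x else m u].

Definition visit x (st : marking * seq T) u :=
  if st.1 u is None then (mark st.1 u (Some x), u :: st.2) else st.

Definition mark_root (m : marking) x : marking :=
  if m x is None then mark m x None else m.

Definition explore (m : marking) x s := foldl (visit x) (mark_root m x, s) (L x).

Lemma visitsP x l m s : let st := foldl (visit x) (m, s) l in
  (forall u, st.1 u = if (u \in l) && (m u == None) then Some (Some x) else m u) /\
  exists2 s1, st.2 = s1 ++ s & forall u, (u \in s1) = (u \in l) && (m u == None).
Proof.
elim/last_ind: l => /= [|l u [IHm [s1 e1 h1]]]; first by split=> //; exists [::].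
rewrite foldl_rcons; case e: (foldl _ _ _) => [m' s'] in IHm e1 *.
rewrite /= in IHm e1; subst s'; rewrite /visit /=; case eu: (m' u) => [o|] /=.
  have hu v : v \in rcons l u -> m v == None -> v \in l.
    rewrite mem_rcons inE => /orP[/eqP->|//] /eqP mv.
    by move: eu; rewrite IHm mv eqxx andbT; case: ifP.
  have hv v : (v \in rcons l u) && (m v == None) = (v \in l) && (m v == None).
    case mv: (m v == None); rewrite ?andbF ?andbT //; apply/idP/idP => [/hu-> //|].
    by rewrite mem_rcons inE => ->; rewrite orbT.
  by split=> [v|]; [rewrite hv | exists s1 => // v; rewrite hv].
have mu : m u = None.
  by move: eu; rewrite IHm; case: ifP.
split=> [v|]; rewrite ?ffunE.
  rewrite mem_rcons inE; case: (v =P u) => [->|_] /=; last by rewrite IHm.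
  by rewrite mu.
exists (u :: s1) => // v; rewrite inE h1 mem_rcons inE.
by case: (v =P u) => [->|] //=; rewrite mu eqxx.
Qed.

(* E is the set of explored vertices. *)
Record search_inv (E : {set T}) (m : marking) (s : seq T) : Prop := SearchInv {
  inv_explored : forall x, x \in E -> m x <> None;
  inv_neighbor : forall x y, x \in E -> G x y -> m y <> None;
  inv_root : forall x, m x = Some None -> x \in E;
  inv_child : forall x p, m x = Some (Some p) -> p \in E /\ G p x;
  inv_roots : forall x y, m x = Some None -> m y = Some None -> ~~ G x y;
  inv_stack : exists s1 s2, [/\ s = s1 ++ s2, forall y, y \in s1 -> m y <> None &
     forall y, m y <> None -> y \notin E -> y \in s1];
  inv_unexplored : forall y, y \notin E -> y \in s;
  inv_connect : forall y z p q, y \notin E -> z \notin E ->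
     m y = Some (Some p) -> m z = Some (Some q) -> connect (within E) p q;
  inv_clique : forall (K : {set T}) x, clique G K -> isolated K -> x \in K ->
     x \in E -> exists2 r, r \in K & forall v, v \in K -> v != r -> m v = Some (Some r)
}.

Lemma search_inv_init s : (forall y, y \in s) -> search_inv set0 [ffun=> None] s.
Proof.
move=> hs; split.
- by move=> x; rewrite inE.
- by move=> x y; rewrite inE.
- by move=> x; rewrite ffunE.
- by move=> x p; rewrite ffunE.
- by move=> x y; rewrite ffunE.
- by exists [::], s; split=> // y; rewrite ffunE.
- by move=> y _; apply: hs.
- by move=> y z p q _ _; rewrite ffunE.
by move=> K x _ _ _; rewrite inE.
Qed.

(** The key is [inv_stack]: marked unexplored vertices lie in a top segment of the stack that holds
    only marked vertices. So as long as such vertices exist, the popped one is marked, and a new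
    root starts only when there are none. *)
Lemma search_inv_step E m x s : search_inv E m (x :: s) ->
  let st := explore m x s in search_inv (x |: E) st.1 st.2.
Proof.
move=> inv; rewrite /explore; set m1 := mark_root m x.
have [] := visitsP x (L x) m1 s; case: (foldl _ _ _) => m2 s2 /= em2 [s3 -> es3] {s2}.
have m1x : m1 x <> None.
  by rewrite /m1 /mark_root; case e: (m x) => [o|] //=; rewrite ?e // ffunE eqxx.
have m1m y : y != x -> m1 y = m y.
  by rewrite /m1 /mark_root => ne; case: (m x) => //; rewrite ffunE (negPf ne).
have m1P y : m y <> None -> m1 y = m y.
  case: (eqVneq y x) => [->|/m1m //]; rewrite /m1 /mark_root.
  by case e: (m x) => [o|].
have m2P y : m y <> None -> m2 y = m y.
  by move=> my; rewrite em2 m1P //; case: eqP => //; rewrite andbF.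
(* On a repeated exploration all neighbours are marked already, and only the pop remains to be
   accounted for. *)
have [xE|xE] := boolP (x \in E).
  have mx := inv_explored inv xE.
  have m2E : m2 = m.
    apply/ffunP=> y; case: (eqVneq y x) => [->|ne]; first exact: m2P.
    rewrite em2 m1m // LE; case Gxy: (G x y) => //=.
    by case: eqP => // my; case: (inv_neighbor inv xE Gxy).
  have s3nil : s3 = [::].
    case: s3 es3 => // u s3 /(_ u); rewrite mem_head LE => /esym/andP[Gxu].
    have ne : u != x by apply: contraTneq Gxu => ->; rewrite sgraph_irrefl.
    by rewrite m1m // => /eqP /(inv_neighbor inv xE Gxu).
  rewrite s3nil (setUidPr _) ?sub1set // m2E; case: inv => i1 i2 i3 i4 i5 i6 i7 i8 i9.
  split=> //; last first.
    move=> y nyE; have := i7 y nyE; rewrite inE.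
    by case/predU1P=> // eyx; rewrite eyx xE in nyE.
  have [[|x' s1] [s2 [/= es h1 h2]]] := i6; first by exists [::], s.
  case: es => ? es; subst x'; exists s1, s2; split=> // y hy.
    by apply: h1; rewrite inE hy orbT.
  move=> nyE; have := h2 y hy nyE; rewrite inE.
  by case/predU1P=> // eyx; rewrite eyx xE in nyE.
have nx : m x <> Some None by move/(inv_root inv); rewrite (negPf xE).
have [s1 [s2 [es hs1 hs2]]] := inv_stack inv.
(* The marked unexplored [y] makes the top segment nonempty, so its head [x] is marked. It is no
   root, since roots are explored; thus it has a parent, to which [inv_connect] applies. *)
have conn y q : y \notin E -> y != x -> m y = Some (Some q) ->
    exists p, [/\ m x = Some (Some p), p \in E /\ q \in E, G p x, G q y & connect (within E) p q].
  move=> yE ne my; have ys1 : y \in s1 by apply: hs2; rewrite ?my.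
  have mx : m x <> None.
    case: s1 ys1 es hs1 {hs2} => // x' s1 _ [<- _] hs1; apply: hs1; exact: mem_head.
  case mx': (m x) mx nx => [[p|]|] // _ _; exists p.
  have [pE Gp] := inv_child inv mx'; have [qE Gq] := inv_child inv my.
  by split=> //; apply: (inv_connect inv xE yE).
have conn2 y q : y \notin x |: E -> m2 y = Some (Some q) -> connect (within (x |: E)) x q.
  rewrite !inE negb_or => /andP[ne yE]; rewrite em2 m1m //.
  case: ifP => _; first by move=> [<-].
  move=> /(conn y q yE ne) [p [_ [pE qE] Gp Gq pq]].
  apply: connect_trans (connect_within (subsetUr _ _) pq); apply: connect1.
  by rewrite /within (symG Gp) !inE eqxx pE orbT.
have m2x : m2 x = m1 x by rewrite em2; case: eqP => //; rewrite andbF.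
have m2new y : m2 y <> None -> [\/ y = x, y \in s3 | m y <> None].
  case: (eqVneq y x) => [->|ne]; first by constructor 1.
  rewrite em2 -es3; case: (y \in s3); first by constructor 2.
  by rewrite m1m //; constructor 3.
have Gm2 y : G x y -> m2 y <> None.
  by move=> Gxy; rewrite em2 LE Gxy /=; case: eqP.
split.
- move=> y /setU1P[->|yE]; first by rewrite m2x.
  by have h := inv_explored inv yE; rewrite m2P.
- move=> y z /setU1P[-> /Gm2 //|yE Gyz].
  by have h := inv_neighbor inv yE Gyz; rewrite m2P.
- move=> y; rewrite em2; case: ifP => // _; case: (eqVneq y x) => [->|ne].
    by rewrite setU11.
  by rewrite m1m // => /(inv_root inv) yE; rewrite setU1r.
- move=> y p; rewrite em2; case: ifP => [|_].
    by rewrite LE => /andP[Gxy _] [<-]; rewrite setU11.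
  have : m1 y = Some (Some p) -> m y = Some (Some p).
    rewrite /m1 /mark_root; case: (m x) => // h; move: h; rewrite ffunE.
    by case: eqP.
  by move=> h /h /(inv_child inv)[pE Gp]; rewrite setU1r.
- have root y : m2 y = Some None -> y = x \/ m y = Some None.
    rewrite em2; case: ifP => // _; case: (eqVneq y x) => [->|ne]; first by left.
    by rewrite m1m //; right.
  (* A neighbour of an earlier root was marked as its child when that root was explored, so it
     cannot become a root itself. *)
  have rootx y : m2 x = Some None -> m y = Some None -> ~~ G y x.
    rewrite m2x /m1 /mark_root => mx my; apply/negP=> Gyx.
    have := inv_neighbor inv (inv_root inv my) Gyx.
    by case e: (m x) mx => [o|] // mx; case: nx; rewrite -mx.
  move=> y z my mz; case: (root _ my) => [ey|hy]; case: (root _ mz) => [ez|hz].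
  + by rewrite ey ez sgraph_irrefl.
  + by rewrite ey in my *; apply: contra (rootx z my hz) => /symG.
  + by rewrite ez in mz *; apply: rootx.
  + exact: (inv_roots inv hy hz).
- have [s1' [s2' [es' hs1' hs2']]] : exists s1' s2', [/\ s = s1' ++ s2',
      forall y, y \in s1' -> m y <> None &
      forall y, m y <> None -> y \notin x |: E -> y \in s1'].
    case: s1 es hs1 hs2 => [|x' s1] /= es hs1 hs2.
      exists [::], s; split=> // y my; rewrite !inE negb_or => /andP[_ yE].
      exact: hs2.
    case: es => ? es; subst x'; exists s1, s2; split=> // y.
      by move=> hy; apply: hs1; rewrite inE hy orbT.
    by move=> my; rewrite !inE negb_or => /andP[ne yE]; have := hs2 _ my yE; rewrite inE (negPf ne).
  exists (s3 ++ s1'), s2'; rewrite es' catA; split=> // y; rewrite mem_cat.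
    case/orP=> [|/hs1' my]; last by rewrite m2P.
    by rewrite es3 em2 => ->.
  move=> /m2new[->|->//|my yE]; first by rewrite setU11.
  by rewrite hs2' ?orbT.
- move=> y; rewrite !inE negb_or => /andP[ne yE]; rewrite mem_cat.
  by have := inv_unexplored inv yE; rewrite inE (negPf ne) /= => ->; rewrite orbT.
- move=> y z p q yE zE my mz.
  apply: connect_trans (conn2 z q zE mz).
  by rewrite within_sym; apply: conn2 my.
move=> K y cK isoK Ky; case: (pickP [pred z in K | z \in E]) => [z /andP[/= Kz zE] _|nK].
  have [r Kr hr] := inv_clique inv cK isoK Kz zE.
  by exists r => // v Kv ne; rewrite m2P hr.
move=> /setU1P[eyx|yE]; last by have := nK y; rewrite /= Ky yE.
subst y; exists x => // v Kv ne.
have Gxv : G x v by apply: cK; rewrite // eq_sym.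
have vE : v \notin E by apply/negP=> vE; have := nK v; rewrite /= Kv vE.
rewrite em2 m1m // LE Gxv /=; case: eqP => // mv.
(* If [v] had an earlier parent [q], then [q] and the parent [p] of [x] would be joined through
   explored vertices. None of these lies in [K], so isolation is violated. *)
case emv: (m v) mv => [[q|]|] // _; last by move: vE; rewrite (inv_root inv emv).
have [p [_ [pE qE] Gp Gq pq]] := conn v q vE ne emv.
have nKE u : u \in E -> u \notin K.
  by move=> uE; apply/negP=> Ku; have := nK u; rewrite /= Ku uE.
have ne' : x != v by rewrite eq_sym.
have /negP[] := isoK x v p q Ky Kv ne' (nKE _ pE) (nKE _ qE) Gp Gq.
by apply: connect_within pq; apply/subsetP=> u uE; rewrite inE nKE.
Qed.

(** * Candidate cliques read off a finished marking *)

Definition finished (m : marking) := exists E, search_inv E m [::].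

(* By diamond-freeness, v, its parent p and the neighbours of v with parent p
   form a clique, and when an isolated clique is first hit by the search, at r,
   all its other vertices become children of r. *)
Definition same_clique (m : marking) v u := (m u == m v) || (m v == Some (Some u)).

Definition clique_at (m : marking) v := v |: [set u | (u \in L v) && same_clique m v u].

(** If [v] is a root, [inv_roots] leaves only [v] itself. Otherwise two siblings adjacent to [v]
    have [v] and the parent as adjacent common neighbours. *)
Lemma clique_at_clique m v : finished m -> clique G (clique_at m v).
Proof.
move=> [E inv]; have inE' x : x \in E.
  by apply/negPn/negP=> /(inv_unexplored inv).
have key u w : G u v -> same_clique m v u -> G w v -> same_clique m v w -> u != w -> G u w.
  rewrite /same_clique; case ev: (m v) (inv_explored inv (inE' v)) => [[p|]|] // _; last first.
    move=> Guv /orP[/eqP mu|/eqP//]; by have := inv_roots inv mu ev; rewrite Guv.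
  have [_ Gpv] := inv_child inv ev.
  move=> Guv /orP[/eqP mu|/eqP[<-]] Gwv /orP[/eqP mw|/eqP[<-]] ne.
  - have [_ Gpu] := inv_child inv mu; have [_ Gpw] := inv_child inv mw.
    by apply: (@diamond_free v p); rewrite // symG.
  - by have [_ /symG] := inv_child inv mu.
  - by have [_] := inv_child inv mw.
  - by rewrite eqxx in ne.
move=> u w /setU1P[->|]; last rewrite inE LE => /andP[/symG Guv su].
  move=> /setU1P[->|]; first by rewrite eqxx.
  by rewrite inE LE => /andP[].
move=> /setU1P[->|]; first by [].
rewrite inE LE => /andP[/symG Gwv sw]; exact: key.
Qed.

(** It suffices to treat a clique of largest size: being inclusion-maximal, it is isolated once it
    has three vertices. *)
Lemma clique_at_large m : finished m -> forall K : {set T}, clique G K -> K != set0 ->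
  exists v, #|K| <= #|clique_at m v|.
Proof.
move=> [E inv]; have inE' x : x \in E.
  by apply/negPn/negP=> /(inv_unexplored inv).
pose cliqueb (K : {set T}) := [forall x in K, forall y in K, (x != y) ==> G x y].
have cliqueP K : reflect (clique G K) (cliqueb K).
  apply: (iffP forall_inP) => h x.
    by move=> y Kx Ky; move/forall_inP: (h x Kx) => /(_ y Ky)/implyP.
  by move=> Kx; apply/forall_inP=> y Ky; apply/implyP; apply: h.
move=> K0 cK0 K0nil.
have [K /cliqueP cK maxK] :=
  @arg_maxnP _ K0 cliqueb (fun K => #|K|) (introT (cliqueP _) cK0).
have le0 := maxK _ (introT (cliqueP _) cK0).
suff [v hv] : exists v, #|K| <= #|clique_at m v| by exists v; apply: leq_trans hv.
have [x Kx] : exists x, x \in K.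
  by apply/set0Pn; rewrite -card_gt0; apply: leq_trans le0; rewrite card_gt0.
(* Of the two ends of an edge at most one is a root; the other one has a parent, which its candidate
   contains. *)
have [le2|gt2] := leqP #|K| 2.
  have [y|none] := pickP [pred y in K | y != x]; last first.
    exists x; rewrite (_ : K = [set x]) ?cards1 ?card_gt0.
      by apply/set0Pn; exists x; rewrite setU11.
    apply/setP=> y; rewrite inE; have := none y; rewrite /=.
    by case: eqP => [->|_]; rewrite ?Kx //= andbT.
  move=> /andP[/= Ky ne]; have Gyx := cK _ _ Ky Kx ne.
  suff key a b : G a b -> m a <> Some None -> 1 < #|clique_at m a|.
    case emx: (m x) => [[p|]|]; [exists x|exists y|].
    - by apply: leq_trans le2 _; apply: (key x y); rewrite ?emx // symG.
    - apply: leq_trans le2 _; apply: (key y x) => // emy.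
      by have := inv_roots inv emy emx; rewrite Gyx.
    by case: (inv_explored inv (inE' x)).
  case ema: (m a) (inv_explored inv (inE' a)) => [[p|]|] // _ Gab _.
  have [_ Gpa] := inv_child inv ema.
  rewrite /clique_at cardsU1 inE LE sgraph_irrefl /= add1n ltnS card_gt0.
  by apply/set0Pn; exists p; rewrite inE LE (symG Gpa) /same_clique ema eqxx orbT.
have isoK : isolated K.
  apply: maximal_clique_isolated => // y nKy; apply/exists_inP.
  apply: contraT => /exists_inPn h; have : cliqueb (y |: K).
    apply/cliqueP=> a b /setU1P[->|Ka] /setU1P[->|Kb] ne; first by rewrite eqxx in ne.
    - by apply/negPn/h.
    - by apply: symG; apply/negPn/h.
    - exact: cK.
  by move/maxK; rewrite /= cardsU1 nKy; lia.
have [r Kr hr] := inv_clique inv cK isoK Kx (inE' x).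
have [v /andP[Kv ne]] : exists v, (v \in K) && (v != r).
  apply/existsP; apply: contraLR gt2 => /existsPn h; rewrite -leqNgt.
  apply: leq_trans (_ : #|[set r]| <= 2); last by rewrite cards1.
  by apply/subset_leq_card/subsetP=> c Kc; move: (h c); rewrite Kc !inE negbK.
(* Seen from [v], the vertex [r] is the parent and all other vertices of [K] are siblings. *)
exists v; apply/subset_leq_card/subsetP=> u Ku; rewrite !inE LE.
case: (eqVneq u v) => //= nuv; rewrite cK 1?eq_sym //= /same_clique (hr v) //.
by case: (eqVneq u r) => [->|nur]; rewrite ?eqxx ?orbT // (hr u) ?eqxx.
Qed.

Lemma clique_at_maximum m v : finished m ->
  (forall u, #|clique_at m u| <= #|clique_at m v|) -> maximum_clique G (clique_at m v).
Proof.
move=> fm hv; split=> [|K cK]; first exact: clique_at_clique.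
have [->|K0] := eqVneq K set0; first by rewrite cards0.
by have [u hu] := clique_at_large fm cK K0; apply: leq_trans hu _.
Qed.

Lemma card_clique_at m v : #|clique_at m v| = (count (same_clique m v) (L v)).+1.
Proof.
rewrite /clique_at cardsU1 inE LE sgraph_irrefl /= add1n; congr _.+1.
rewrite -size_filter -(card_uniqP _); last by rewrite filter_uniq //; case: (adjL v).
by apply: eq_card => u; rewrite inE mem_filter andbC.
Qed.

Lemma perm_clique_at m v :
  perm_eq (v :: filter (same_clique m v) (L v)) (enum (clique_at m v)).
Proof.
apply: uniq_perm; rewrite ?enum_uniq //=.
  by rewrite mem_filter LE sgraph_irrefl andbF filter_uniq //; case: (adjL v).
by move=> u; rewrite mem_enum !inE mem_filter andbC.
Qed.

End Search.
End Structure.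

(** * Degree sum and number of edges *)

Section Handshake.
Variables (n : nat) (G : sgraph 'I_n) (L : 'I_n -> seq 'I_n).

(** The degrees count ordered adjacent pairs. Increasing pairs inject into the edges, and so do
    decreasing ones, as the order recovers the pair from its set. *)
Lemma sum_degrees_le : adjacency_lists G L -> \sum_v size (L v) <= 2 * #|edges G|.
Proof.
move=> adjL; pose P := [set p : 'I_n * 'I_n | G p.1 p.2].
have -> : \sum_v size (L v) = #|P|.
  rewrite -sum1_card (eq_bigl (fun p : 'I_n * 'I_n => G p.1 p.2)); last by move=> p; rewrite inE.
  rewrite -(pair_big_dep xpredT (fun x y => G x y) (fun _ _ => 1)) /=.
  apply: eq_bigr => v _; have [u e] := adjL v; rewrite sum1_card -(card_uniqP u).
  by apply: eq_card => w; rewrite e.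
pose Q := [set p in P | p.1 < p.2]; pose Q' := [set p in P | p.2 < p.1].
have sPQ : P \subset Q :|: Q'.
  apply/subsetP=> -[x y]; rewrite !inE /= => Gxy; rewrite Gxy -neq_ltn.
  by apply: contraTneq Gxy => /val_inj->; rewrite sgraph_irrefl.
have inj (A : {set 'I_n * 'I_n}) : A \subset P ->
   {in A &, injective (fun p => [set p.1; p.2])} -> #|A| <= #|edges G|.
  move=> sAP iA; rewrite -(card_in_imset iA); apply: subset_leq_card.
  apply/subsetP=> E /imsetP[p Ap ->]; apply/imsetP; exists p => //.
  by have := subsetP sAP p Ap; rewrite !inE.
apply: leq_trans (subset_leq_card sPQ) _; apply: leq_trans (leq_card_setU _ _) _.
rewrite mul2n -addnn; apply: leq_add; apply: inj.
- by apply/subsetP=> p; rewrite inE => /andP[].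
- move=> [x y] [x' y']; rewrite !inE /= => /andP[_ lt] /andP[_ lt'] e.
  have := set21 x y; have := set22 x y; rewrite e !inE.
  case/orP=> /eqP ey; case/orP=> /eqP ex; subst; lia || by [].
- by apply/subsetP=> p; rewrite inE => /andP[].
- move=> [x y] [x' y']; rewrite !inE /= => /andP[_ lt] /andP[_ lt'] e.
  have := set21 x y; have := set22 x y; rewrite e !inE.
  case/orP=> /eqP ey; case/orP=> /eqP ex; subst; lia || by [].
Qed.
End Handshake.

(** * Structured programs for the random access machine *)

(* [Unless i c] runs c when register i is 0, [Rep c i] runs c at least once and
   as long as register i is positive afterwards. *)
Inductive cmd :=
| Basic of instr
| Seq of cmd & cmd
| Unless of nat & cmd
| Rep of cmd & nat.

(* Registers below nreg are the scalars [reg], all others form the [heap]; [tm]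
   counts the executed instructions. *)
Record cfg := Cfg {
  reg : nat -> nat;
  heap : nat -> nat;
  inp : seq nat;
  out : seq nat;
  tm : nat
}.

Definition nreg := 20.

Definition upd (f : nat -> nat) (i v : nat) := fun a => if eqn a i then v else f a.
Arguments upd f i v a /.

(** A synonym that [sym_exec] leaves folded: scalar registers are numerals and compare by
    computation, heap addresses are symbolic and need arithmetic. *)
Definition upd_heap := upd.

Lemma upd_heapE f i v a : upd_heap f i v a = if a == i then v else f a.
Proof. by rewrite /upd_heap /= eqnE. Qed.

Definition setR s i v := Cfg (upd (reg s) i v) (heap s) (inp s) (out s) (tm s).+1.
Definition tick s := Cfg (reg s) (heap s) (inp s) (out s) (tm s).+1.

Definition bstep (i : instr) (s : cfg) : cfg :=
  match i with
  | IConst i k => setR s i k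
  | IAdd i j k => setR s i (reg s j + reg s k)
  | ISub i j k => setR s i (reg s j - reg s k)
  | ILoad i j => setR s i (heap s (reg s j))
  | IStore i j => Cfg (reg s) (upd_heap (heap s) (reg s i) (reg s j)) (inp s) (out s) (tm s).+1
  | IRead i =>
      Cfg (upd (reg s) i (head 0 (inp s))) (heap s) (behead (inp s)) (out s) (tm s).+1
  | IWrite i => Cfg (reg s) (heap s) (inp s) (rcons (out s) (reg s i)) (tm s).+1
  | _ => s
  end.

(** These are the obligations of a safe step: the value written fits in a word, and indirect access
    stays off the scalars. Truncated subtraction cannot exceed its first operand; jumps are left to
    the compiler. *)
Definition bok (B : nat) (i : instr) (s : cfg) : Prop :=
  match i with
  | IConst i k => k <= B
  | IAdd i j k => reg s j + reg s k <= B
  | ILoad i j => nreg <= reg s j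
  | IStore i j => nreg <= reg s i
  | IRead i => head 0 (inp s) <= B
  | ISub _ _ _ | IWrite _ => True
  | IJumpPos _ _ | IHalt => False
  end.

Definition regs_ok (i : instr) : bool :=
  match i with
  | IConst i k => i < nreg
  | IAdd i j k | ISub i j k => [&& i < nreg, j < nreg & k < nreg]
  | ILoad i j | IStore i j => (i < nreg) && (j < nreg)
  | IRead i | IWrite i => i < nreg
  | IJumpPos _ _ | IHalt => false
  end.

Fixpoint wf (c : cmd) : bool :=
  match c with
  | Basic i => regs_ok i
  | Seq c1 c2 => wf c1 && wf c2
  | Unless i c => (i < nreg) && wf c
  | Rep c i => (i < nreg) && wf c
  end.

Fixpoint csize (c : cmd) : nat :=
  match c with
  | Basic i => 1
  | Seq c1 c2 => csize c1 + csize c2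
  | Unless i c => (csize c).+1
  | Rep c i => (csize c).+1
  end.

(** Jump targets are absolute, so the code depends on its start [l]. The polarities of [Unless] and
    [Rep] are those for which a single [IJumpPos] suffices. *)
Fixpoint compile (l : nat) (c : cmd) : program :=
  match c with
  | Basic i => [:: i]
  | Seq c1 c2 => compile l c1 ++ compile (l + csize c1) c2
  | Unless i c => IJumpPos i (l.+1 + csize c) :: compile l.+1 c
  | Rep c i => rcons (compile l c) (IJumpPos i l)
  end.

Lemma size_compile l c : size (compile l c) = csize c.
Proof.
elim: c l => //= [c1 IH1 c2 IH2|i c IH|c IH i] l.
- by rewrite size_cat IH1 IH2.
- by rewrite IH.
- by rewrite size_rcons IH.
Qed.

Inductive exec (B : nat) : cmd -> cfg -> cfg -> Prop :=
| ExecBasic i s : bok B i s -> exec B (Basic i) s (bstep i s)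
| ExecSeq c1 c2 s s1 s2 :
    exec B c1 s s1 -> exec B c2 s1 s2 -> exec B (Seq c1 c2) s s2
| ExecSkip i c s : 0 < reg s i -> exec B (Unless i c) s (tick s)
| ExecUnless i c s s1 :
    reg s i = 0 -> exec B c (tick s) s1 -> exec B (Unless i c) s s1
| ExecStop i c s s1 :
    exec B c s s1 -> reg s1 i = 0 -> exec B (Rep c i) s (tick s1)
| ExecMore i c s s1 s2 :
    exec B c s s1 -> 0 < reg s1 i -> exec B (Rep c i) (tick s1) s2 ->
    exec B (Rep c i) s s2.

Definition mem (s : cfg) (a : nat) := if a < nreg then reg s a else heap s a.

Definition represents (st : state) (s : cfg) : Prop :=
  [/\ regs st =1 mem s, input st = inp s & output st = out s].

Definition bounded B (st : state) := forall a, regs st a <= B.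

Definition code_at (P : program) l (c : program) :=
  forall k, k < size c -> nth IHalt P (l + k) = nth IHalt c k.

Lemma code_at_cat P l c1 c2 :
  code_at P l (c1 ++ c2) -> code_at P l c1 /\ code_at P (l + size c1) c2.
Proof.
move=> h; split=> k lt_k.
  by rewrite h ?size_cat ?ltn_addr // nth_cat lt_k.
by rewrite -addnA h ?size_cat ?ltn_add2l // nth_cat ltnNge leq_addr /= addKn.
Qed.

Lemma step_basic B P i s st : regs_ok i -> bok B i s -> fetch P st = i ->
  represents st s -> bounded B st ->
  [/\ represents (step P st) (bstep i s), pc (step P st) = (pc st).+1,
      bounded B (step P st) & tm (bstep i s) = (tm s).+1].
Proof.
have memR j : j < nreg -> mem s j = reg s j by rewrite /mem => ->.
have memH j : nreg <= j -> mem s j = heap s j by rewrite /mem ltnNge => ->.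
move=> ri oi fi [eR eI eO] bd.
have setP j v (st0 : state) (s0 : cfg): 
   j < nreg -> regs st0 = regs st -> reg s0 = upd (reg s) j v -> heap s0 = heap s ->
   regs (set_reg st0 j v) =1 mem s0.
  move=> lj e0 e1 e2 a; rewrite /= e0 /mem e1 e2 /= eqnE.
  case: (a =P j) => [->|_]; first by rewrite lj.
  by rewrite eR.
rewrite /step fi; case: i ri oi fi => //= [i k|i j k|i j k|i j|i j|i|i] ri oi _.
- split=> //; first by split=> //; apply: setP.
  by move=> a /=; case: ifP.
- have [ri1 rj rk] := and3P ri; rewrite !eR !memR //.
  split=> //; first by split=> //; apply: setP.
  by move=> a /=; case: ifP.
- have [ri1 rj rk] := and3P ri; rewrite !eR !memR //.
  split=> //; first by split=> //; apply: setP.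
  move=> a /=; case: ifP => // _; apply: leq_trans (leq_subr _ _) _.
  by rewrite -memR // -eR.
- have [ri1 rj] := andP ri; rewrite !eR (memR j) // memH //.
  split=> //; first by split=> //; apply: setP.
  by move=> a /=; case: ifP => // _; rewrite -memH // -eR.
- have [ri1 rj] := andP ri; rewrite !eR !memR //; split=> //.
    split=> // a /=; rewrite /mem /= upd_heapE; case: (a =P _) => [->|_].
      by rewrite ltnNge oi.
    exact: eR.
  by move=> a /=; case: ifP => // _; rewrite -memR // -eR.
- rewrite eI; split=> //.
    by split=> //=; apply: setP.
  by move=> a /=; case: ifP.
- by rewrite eR memR //; split=> //; split=> //=; rewrite eO.
Qed.

Definition reaches B P (st : state) (s : cfg) (l : nat) (s' : cfg) :=
  exists t, [/\ represents (iter t (step P) st) s', pc (iter t (step P) st) = l,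
    tm s' = tm s + t & forall i, i <= t -> bounded B (iter i (step P) st)].

Lemma reaches_trans B P st s l s1 l2 s2 : reaches B P st s l s1 ->
  (forall st1, represents st1 s1 -> pc st1 = l -> bounded B st1 ->
     reaches B P st1 s1 l2 s2) -> reaches B P st s l2 s2.
Proof.
move=> [t [r1 p1 m1 b1]] /(_ _ r1 p1 (b1 _ (leqnn t))) [t' [r2 p2 m2 b2]].
exists (t' + t); rewrite iterD; split=> //; first by rewrite m2 m1; lia.
move=> i; case: (leqP i t) => [/b1//|lt_i le_i].
rewrite -(subnK (ltnW lt_i)) iterD; apply: b2; lia.
Qed.

Lemma reaches1 B P st s s' : bounded B st ->
  [/\ represents (step P st) s', bounded B (step P st) & tm s' = (tm s).+1] ->
  reaches B P st s (pc (step P st)) s'.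
Proof.
move=> b0 [r1 b1 t1]; exists 1; split=> //; first by rewrite t1 addn1.
by case=> [|[|]].
Qed.

Lemma jump_reaches B P i l s st : i < nreg -> fetch P st = IJumpPos i l ->
  represents st s -> bounded B st ->
  reaches B P st s (if 0 < reg s i then l else (pc st).+1) (tick s).
Proof.
move=> ri fi [eR eI eO] bd.
have -> : (if 0 < reg s i then l else (pc st).+1) = pc (step P st).
  by rewrite /step fi /= eR /mem ri.
by apply: reaches1 => //; split; rewrite /step ?fi.
Qed.

(** The induction runs over the execution, not over the command, so that the remaining rounds of a
    [Rep] are covered by a hypothesis about the same command. *)
Lemma compile_correct B P c s s' : exec B c s s' -> wf c ->
  forall l st, code_at P l (compile l c) -> represents st s -> pc st = l ->
    bounded B st -> reaches B P st s (l + csize c) s'.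
Proof.
elim=> {c s s'} /= [i s oi|c1 c2 s s1 s2 _ IH1 _ IH2|i c s gt0|i c s s1 eq0 _ IH|
  i c s s1 _ IH eq0|i c s s1 s2 _ IH1 gt0 _ IH2] wfc l st hc rs hp bd.
- have fi : fetch P st = i by rewrite /fetch hp -[l]addn0 hc.
  have [h1 h2 h3 h4] := step_basic wfc oi fi rs bd.
  by rewrite -hp addn1 -h2; apply: reaches1.
- have [w1 w2] := andP wfc; have [hc1] := code_at_cat hc.
  rewrite size_compile => hc2.
  apply: (reaches_trans (IH1 w1 _ _ hc1 rs hp bd)) => st1 rs1 hp1 bd1.
  by rewrite addnA; apply: IH2.
- have [ri wc] := andP wfc.
  have fi : fetch P st = IJumpPos i (l.+1 + csize c).
    by rewrite /fetch hp -[l in LHS]addn0 hc.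
  have := jump_reaches ri fi rs bd; rewrite gt0; congr (reaches _ _ _ _ _); lia.
- have [ri wc] := andP wfc.
  have fi : fetch P st = IJumpPos i (l.+1 + csize c).
    by rewrite /fetch hp -[l in LHS]addn0 hc.
  have := jump_reaches ri fi rs bd; rewrite eq0 /= hp => h.
  apply: reaches_trans h _ => st1 rs1 hp1 bd1; rewrite -addSnnS; apply: IH => //.
  by move=> k lt_k; rewrite addSnnS hc.
- have [ri wc] := andP wfc; rewrite -cats1 in hc.
  have [hc1] := code_at_cat hc; rewrite size_compile => hc2.
  apply: (reaches_trans (IH wc _ _ hc1 rs hp bd)) => st1 rs1 hp1 bd1.
  have fi : fetch P st1 = IJumpPos i l.
    by rewrite /fetch hp1 -[l + csize c]addn0 hc2.
  by have := jump_reaches ri fi rs1 bd1; rewrite eq0 /= hp1 addnS.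
- have [ri wc] := andP wfc; have := hc; rewrite -cats1 => hc'.
  have [hc1] := code_at_cat hc'; rewrite size_compile => hc2.
  apply: (reaches_trans (IH1 wc _ _ hc1 rs hp bd)) => st1 rs1 hp1 bd1.
  have fi : fetch P st1 = IJumpPos i l.
    by rewrite /fetch hp1 -[l + csize c]addn0 hc2.
  have := jump_reaches ri fi rs1 bd1; rewrite gt0 => h.
  by apply: (reaches_trans h) => st2 rs2 hp2 bd2; apply: IH2.
Qed.

(** * A calculus of total correctness *)

Definition wp B c (Q : cfg -> Prop) (s : cfg) := exists2 s', exec B c s s' & Q s'.

Lemma wp_computes B c w T (P : seq nat -> Prop) : wf c ->
  wp B c (fun s => tm s <= T /\ P (out s)) (Cfg (fun=> 0) (fun=> 0) w [::] 0) ->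
  exists2 r, computes_within T B (compile 0 c) w r & P r.
Proof.
move=> wfc [s' ex [le_T Pr]]; exists (out s') => //.
have [] := @compile_correct B (compile 0 c) c _ _ ex wfc 0 (init w) => //.
  by split=> // a; rewrite /mem if_same.
move=> t [[_ _ eO] hp et hb]; exists t; first by rewrite -(add0n t) -et.
split=> //; last by move=> i a /hb.
(* The program counter stands just past the code, where [fetch] defaults to [IHalt]. *)
by rewrite /halted /fetch hp nth_default // size_compile.
Qed.

Lemma wp_conseq B c (Q Q' : cfg -> Prop) s :
  (forall s', Q s' -> Q' s') -> wp B c Q s -> wp B c Q' s.
Proof. by move=> h [s' ex /h]; exists s'. Qed.

Lemma wp_seq B c1 c2 Q s : wp B c1 (wp B c2 Q) s -> wp B (Seq c1 c2) Q s.
Proof. by move=> [s1 e1 [s2 e2 hQ]]; exists s2 => //; apply: ExecSeq e2. Qed.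

Lemma wp_unless B i c Q s :
  (if reg s i is 0 then wp B c Q (tick s) else Q (tick s)) -> wp B (Unless i c) Q s.
Proof.
case e: (reg s i) => [|k]; first by move=> [s1 ex hQ]; exists s1 => //; apply: ExecUnless.
by exists (tick s) => //; apply: ExecSkip; rewrite e.
Qed.

(** The index of the invariant is a variant, which must drop whenever another round follows; this
    gives termination. *)
Lemma wp_rep B i c (I : nat -> cfg -> Prop) Q k s :
  (forall k s, I k s -> wp B c (fun s' =>
     if reg s' i is 0 then Q (tick s') else exists2 k', k' < k & I k' (tick s')) s) ->
  I k s -> wp B (Rep c i) Q s.
Proof.
move=> h; elim/ltn_ind: k s => k IH s /h [s1 ex].
case e: (reg s1 i) => [|m]; first by exists (tick s1) => //; apply: ExecStop.
move=> [k' lt_k /(IH _ lt_k)[s2 ex2 hQ]]; exists s2 => //.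
by apply: ExecMore ex2; rewrite ?e.
Qed.

(** Computing the precondition turns straight-line code into a plain conjunction; at a [Rep] it
    stops, since an invariant has to be supplied. *)
Fixpoint wps B c (Q : cfg -> Prop) s : Prop :=
  match c with
  | Basic i => bok B i s /\ Q (bstep i s)
  | Seq c1 c2 => wps B c1 (wps B c2 Q) s
  | Unless i c => if reg s i is 0 then wps B c Q (tick s) else Q (tick s)
  | Rep c i => wp B (Rep c i) Q s
  end.

Lemma wps_wp B c Q s : wps B c Q s -> wp B c Q s.
Proof.
elim: c Q s => [i|c1 IH1 c2 IH2|i c IH|c IH i] Q s //=.
- by move=> [oi hQ]; exists (bstep i s) => //; apply: ExecBasic.
- by move/IH1=> h; apply: wp_seq; apply: wp_conseq h => s' /IH2.
- by move=> h; apply: wp_unless; case: (reg s i) h => // /IH.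
Qed.

(** * The program *)
Notation "c1 ;; c2" := (Seq c1 c2) (at level 61, right associativity).
Coercion Basic : instr >-> cmd.

(* Register roles: rT, rE, rY scratch; rO the constant 1; rN = n; rF, rP, rK the
   base addresses of the array of offsets into the adjacency lists, of the
   marks and of the stack; rS the stack pointer; rV the current vertex; rA, rD,
   rU address, countdown and value in a loop over neighbours; rX a mark; rC, rB
   current and best count; rW the best vertex. *)
Notation rT := 0 (only parsing).
Notation rO := 1 (only parsing).
Notation rN := 2 (only parsing).
Notation rF := 3 (only parsing).
Notation rP := 4 (only parsing).
Notation rK := 5 (only parsing).
Notation rS := 6 (only parsing).
Notation rV := 7 (only parsing).
Notation rA := 8 (only parsing).
Notation rD := 9 (only parsing).
Notation rU := 10 (only parsing).
Notation rX := 11 (only parsing).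
Notation rE := 12 (only parsing).
Notation rC := 13 (only parsing).
Notation rB := 14 (only parsing).
Notation rW := 15 (only parsing).
Notation rY := 16 (only parsing).

(** With [rO] equal to 1, the difference is 0 exactly when register [i] is positive. Such a guard is
    needed before a [Rep], which always runs once. *)
Definition when_pos (i : nat) (c : cmd) : cmd := ISub rT rO i ;; Unless rT c.

Definition for_neighbors (body : cmd) : cmd :=
  (IAdd rT rF rV ;; ILoad rA rT ;; ILoad rD rA) ;;
  when_pos rD (Rep ((IAdd rA rA rO ;; ILoad rU rA) ;; body ;; ISub rD rD rO) rD).

Definition read_graph : cmd :=
  (IConst rF 20 ;; IAdd rP rF rN ;; IAdd rK rP rN ;; IAdd rA rK rN ;;
   IAdd rA rA rN ;; IConst rV 0 ;; IAdd rS rK rV) ;;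
  Rep ((IAdd rT rF rV ;; IStore rT rA ;; IStore rS rV ;; IAdd rS rS rO ;;
        IRead rD ;; IStore rA rD ;; IAdd rA rA rO) ;;
       when_pos rD
         (Rep (IRead rU ;; IStore rA rU ;; IAdd rA rA rO ;; ISub rD rD rO) rD) ;;
       (IAdd rV rV rO ;; ISub rT rN rV)) rT.

(* A mark is 0 if unset, n + 1 for a root, p + 1 for a child of p. *)
Definition visit_body : cmd :=
  IAdd rT rP rU ;; ILoad rE rT ;;
  Unless rE (IStore rT rX ;; IStore rS rU ;; IAdd rS rS rO).

(* The stack initially holds all vertices, so a vertex may be popped twice;
   the second exploration changes nothing. *)
Definition search : cmd :=
  Rep ((ISub rS rS rO ;; ILoad rV rS ;; IAdd rT rP rV ;; ILoad rE rT ;;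
        IAdd rX rN rO ;; Unless rE (IStore rT rX) ;; IAdd rX rV rO) ;;
       for_neighbors visit_body ;; ISub rT rS rK) rT.

(* rE becomes 0 when the mark of rU is rX or rU is the parent encoded by rX;
   X = Y is tested through (X - Y) + (Y - X). *)
Definition test_clique : cmd :=
  IAdd rT rP rU ;; ILoad rT rT ;; ISub rE rT rX ;; ISub rT rX rT ;;
  IAdd rE rE rT ;; IAdd rY rU rO ;; ISub rT rY rX ;; ISub rY rX rY ;;
  IAdd rT rT rY ;; Unless rT (IConst rE 0).

Definition count_body : cmd := test_clique ;; Unless rE (IAdd rC rC rO).

(** The best vertex is replaced also on ties, so the first vertex is recorded even if its count is
    0. Adding [rY], set to 0, copies a register. *)
Definition count_cliques : cmd :=
  (IConst rV 0 ;; IConst rB 0 ;; IConst rW 0) ;;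
  Rep ((IConst rC 0 ;; IAdd rT rP rV ;; ILoad rX rT) ;; for_neighbors count_body ;;
       (ISub rT rB rC ;;
        Unless rT (IConst rY 0 ;; IAdd rB rC rY ;; IAdd rW rV rY) ;;
        IAdd rV rV rO ;; ISub rT rN rV)) rT.

Definition write_body : cmd := test_clique ;; Unless rE (IWrite rU).

Definition write_clique : cmd :=
  (IConst rY 0 ;; IAdd rV rW rY ;; IWrite rV ;; IAdd rT rP rV ;; ILoad rX rT) ;;
  for_neighbors write_body.

Definition clique_cmd : cmd :=
  (IRead rN ;; IConst rO 1) ;;
  when_pos rN (read_graph ;; search ;; count_cliques ;; write_clique).

Ltac sym_exec :=
  apply: wps_wp;
  cbn [wps bok nreg bstep setR tick reg heap inp out tm upd eqn when_pos]; rewrite /nreg.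

(** * Verification of the program *)

Section Program.
Variables (n : nat) (G : sgraph 'I_n) (L : 'I_n -> seq 'I_n).
Hypothesis adjL : adjacency_lists G L.

(* Cells 20 .. 20+n-1 hold the offsets, then come n marks, 2n stack cells and,
   from 20+4n on, the degree and the neighbours of each vertex. *)
Definition off (k : nat) := 20 + 4 * n + \sum_(u : 'I_n | u < k) (size (L u)).+1.

Lemma offS (v : 'I_n) : off v.+1 = off v + (size (L v)).+1.
Proof.
rewrite /off (bigD1 v) //=.
rewrite (eq_bigl (fun u : 'I_n => u < v)); first by lia.
by move=> u; rewrite ltnS ltn_neqAle andbC.
Qed.

Lemma leq_off j k : j <= k -> off j <= off k.
Proof.
move=> le_jk; rewrite leq_add2l [leqRHS](bigID (fun u : 'I_n => u < j)) /=.
apply: leq_trans (leq_addr _ _); rewrite leq_eqVlt; apply/orP; left; apply/eqP.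
apply: eq_bigl => u; lia.
Qed.

Lemma off0 : off 0 = 20 + 4 * n.
Proof. by rewrite /off big_pred0 ?addn0. Qed.

Lemma offn : off n = 20 + 5 * n + \sum_u size (L u).
Proof.
have -> : off n = 20 + 4 * n + \sum_(u < n) (1 + size (L u)).
  by congr addn; apply: eq_bigl => u; rewrite ltn_ord.
rewrite big_split /= sum_nat_const card_ord.
lia.
Qed.

Lemma off_bounds (v : 'I_n) : 20 + 4 * n <= off v /\ off v + size (L v) < off n.
Proof.
have := leq_off (leq0n v); have := leq_off (ltn_ord v); rewrite offS off0.
by lia.
Qed.

Variable B : nat.
Hypothesis leB : off n <= B.

Definition adj_mem (h : nat -> nat) := forall v : 'I_n,
  [/\ h (20 + v) = off v, h (off v) = size (L v) &
      forall i, i < size (L v) -> h (off v + i.+1) = nth 0 [seq val u | u <- L v] i].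

Lemma adj_mem_upd h a x : 20 + n <= a < 20 + 4 * n -> adj_mem h -> adj_mem (upd_heap h a x).
Proof.
move=> ha hh v; have [h1 h2 h3] := hh v; have [b1 b2] := off_bounds v.
have lt_v := ltn_ord v.
split=> [||i lt_i]; rewrite upd_heapE ifN ?h1 ?h2 ?h3 //; lia.
Qed.

Definition base (s : cfg) :=
  [/\ reg s rO = 1, reg s rN = n, reg s rF = 20, reg s rP = 20 + n & reg s rK = 20 + 2 * n].

Definition agree (s s' : cfg) := [/\ heap s' = heap s, inp s' = inp s, out s' = out s &
  forall r, r \notin [:: rT; rA; rD; rU] -> reg s' r = reg s r].

(** [J l] describes the state after the neighbours in [l], and has to be insensitive to the loop's
    own registers. Each round costs four instructions besides the at most [k] of the body. *)
Lemma wp_for_neighbors (v : 'I_n) body k (J : seq 'I_n -> cfg -> Prop) Q s :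
  (forall l s1 s2, agree s1 s2 -> J l s1 -> J l s2) ->
  (forall l s1, J l s1 -> [/\ adj_mem (heap s1), reg s1 rO = 1, reg s1 rF = 20 & reg s1 rV = v]) ->
  (forall l u r s1, L v = l ++ u :: r -> J l s1 -> reg s1 rU = u ->
     wp B body (fun s2 => [/\ J (rcons l u) s2, reg s2 rA = reg s1 rA, reg s2 rD = reg s1 rD
                            & tm s2 <= tm s1 + k]) s1) ->
  J [::] s ->
  (forall s1, J (L v) s1 -> tm s1 <= tm s + 6 + (k + 4) * size (L v) -> Q s1) ->
  wp B (for_neighbors body) Q s.
Proof.
move=> Jagree Jbase Jbody J0 hQ; have [bv1 bv2] := off_bounds v; have lt_v := ltn_ord v.
have [am e1 eF eV] := Jbase _ _ J0; have [h1 h2 h3] := am v.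
rewrite /for_neighbors; sym_exec.
rewrite eF eV h1 h2 e1.
split; first by lia.
split; first by lia.
split; first by lia.
split=> //.
case eD: (1 - size (L v)) => [|d]; last first.
  have nilL : L v = [::] by apply/nilP; rewrite /nilp; lia.
  apply: hQ; last by rewrite nilL /=; lia.
  rewrite nilL; apply: (Jagree _ _ _ _ J0); split=> // r; rewrite !inE !negb_or.
  by case/and4P=> /negPf r1 /negPf r2 /negPf r3 /negPf r4; rewrite /= !eqnE r1 r2 r3.
pose I d s1 := exists l r, [/\ L v = l ++ r, size r = d, J l s1,
  reg s1 rA = off v + size l & reg s1 rD = d] /\ (0 < d /\ tm s1 <= tm s + 5 + (k + 4) * size l).
apply: (@wp_rep _ _ _ I _ (size (L v))); last first.
  exists [::], (L v); split; last by split; [lia | rewrite /=; lia].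
  split=> //=; last by rewrite addn0.
  apply: (Jagree _ _ _ _ J0); split=> // r; rewrite !inE !negb_or.
  by case/and4P=> /negPf r1 /negPf r2 /negPf r3 /negPf r4; rewrite /= !eqnE r1 r2 r3.
move=> {eD}d s1 [l [[|u r] [[eL <- Jl eA eD] [d_gt0 le_tm]]]] //.
have [am1 e1' _ _] := Jbase _ _ Jl; have [_ _ h3'] := am1 v.
apply: wp_seq; sym_exec.
rewrite eA e1'.
have szL : size (L v) = size l + (size r).+1 by rewrite eL size_cat.
split; first by lia.
split; first by lia.
apply: wp_seq.
have hu : heap s1 (off v + size l + 1) = u.
  by rewrite addn1 -addnS h3' ?szL -?addSnnS ?leq_addr // eL map_cat nth_cat size_map ltnn subnn.
set s2 := (X in wp _ _ _ X).
have J2 : J l s2.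
  apply: (Jagree _ _ _ _ Jl); split=> // q; rewrite !inE !negb_or.
  by case/and4P=> /negPf r1 /negPf r2 /negPf r3 /negPf r4; rewrite /= !eqnE r2 r4.
have := Jbody l u r s2 eL J2 hu.
apply: wp_conseq => s3 [J3 eA3 eD3 tm3].
sym_exec.
have [_ e13 _ _] := Jbase _ _ J3.
split=> //.
have {}eD3 : reg s3 rD = (size r).+1 := etrans eD3 eD.
have {}eA3 : reg s3 rA = off v + size l + 1 := eA3.
have {}tm3 : tm s3 <= (tm s1).+2 + k := tm3.
rewrite eD3 e13 subn1 /=.
have J4 t X : X = size r -> J (rcons l u) (Cfg (upd (reg s3) 9 X) (heap s3) (inp s3) (out s3) t).
  move=> _; apply: (Jagree _ _ _ _ J3); split=> // q; rewrite !inE !negb_or.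
  by case/and4P=> /negPf r1 /negPf r2 /negPf r3 /negPf r4; rewrite /= !eqnE r3.
case er: (size r) => [|d'].
  apply: hQ; last by rewrite /= szL; lia.
  have -> : L v = rcons l u by rewrite eL (size0nil er) cats1.
  by apply: J4; rewrite er.
exists d'.+1; first by lia.
exists (rcons l u), r; split; last by split; [lia|rewrite /= size_rcons; lia].
split=> //=; first by rewrite cat_rcons.
  by apply: J4; rewrite er.
by rewrite size_rcons; apply: (etrans eA3); lia.
Qed.


Definition block v := size (L v) :: [seq val u | u <- L v].

Lemma wp_read_block (v : 'I_n) rest Q s :
  reg s rO = 1 -> reg s rD = size (L v) -> reg s rA = (off v).+1 ->
  inp s = [seq val u | u <- L v] ++ rest ->
  (forall s1, [/\ reg s1 rA = off v.+1, inp s1 = rest, out s1 = out s &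
      forall r, r \notin [:: rT; rA; rD; rU] -> reg s1 r = reg s r] ->
    (forall a, heap s1 a = if off v < a <= off v + size (L v)
       then nth 0 [seq val u | u <- L v] (a - (off v).+1) else heap s a) ->
    tm s1 <= tm s + 3 + 5 * size (L v) -> Q s1) ->
  wp B (when_pos rD
         (Rep (IRead rU ;; IStore rA rU ;; IAdd rA rA rO ;; ISub rD rD rO) rD)) Q s.
Proof.
move=> eO eD eA eI hQ; have [bv1 bv2] := off_bounds v; have lt_v := ltn_ord v.
sym_exec; rewrite eO eD; split=> //.
case eL: (1 - size (L v)) => [|d]; last first.
  have nilL : L v = [::] by apply/nilP; rewrite /nilp; lia.
  apply: hQ; last by rewrite nilL /=; lia.
    split=> //=; first by rewrite offS nilL addn1.
    - by rewrite eI nilL.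
    by move=> r; rewrite !inE !negb_or => /and4P[/negPf r1 _ _ _]; rewrite eqnE r1.
  by move=> a; rewrite nilL /= ifN //; lia.
pose I d s1 := exists l r, [/\ L v = l ++ r, size r = d, reg s1 rD = d,
    reg s1 rA = (off v).+1 + size l & inp s1 = [seq val u | u <- r] ++ rest] /\
  [/\ 0 < d, out s1 = out s, forall r, r \notin [:: rT; rA; rD; rU] -> reg s1 r = reg s r,
    forall a, heap s1 a = if off v < a <= off v + size l
       then nth 0 [seq val u | u <- L v] (a - (off v).+1) else heap s a &
    tm s1 <= tm s + 2 + 5 * size l].
apply: (@wp_rep _ _ _ I _ (size (L v))); last first.
  exists [::], (L v); split; split=> //=; try lia.
    by move=> r; rewrite !inE !negb_or => /and4P[/negPf r1 _ _ _]; rewrite eqnE r1.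
  by move=> a; rewrite ifN //; lia.
move=> {eL}d s1 [l [[|u r] [[eL <- eD1 eA1 eI1] [d_gt0 eo1 er1 eh1 tm1]]]] //.
have szL : size (L v) = size l + (size r).+1 by rewrite eL size_cat.
have lt_u := ltn_ord u.
sym_exec; rewrite eI1 eA1 eD1 er1 // eO subn1 /=.
split; first by lia.
split; first by lia.
split; first by lia.
split=> //.
set s2 := tick _.
have h2 a : heap s2 a = if off v < a <= off v + (size l).+1
       then nth 0 [seq val u | u <- L v] (a - (off v).+1) else heap s a.
  rewrite /= upd_heapE; case: eqP => [->|ne].
    rewrite ifT; last by lia.
    by rewrite addKn eL map_cat nth_cat size_map ltnn subnn.
  rewrite eh1; congr (if _ then _ else _); lia.
have r2 q : q \notin [:: rT; rA; rD; rU] -> reg s2 q = reg s q.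
  move=> hq; rewrite -er1 //; move: hq; rewrite !inE !negb_or.
  by case/and4P=> /negPf r1 /negPf r2 /negPf r3 /negPf r4; rewrite /= !eqnE r2 r3 r4.
have t2 : tm s2 <= tm s + 2 + 5 * (size l).+1 by rewrite /=; lia.
case er: (size r) => [|d'].
  have nilr := size0nil er.
  apply: hQ => //; last by rewrite szL er; lia.
    split=> //=; first by rewrite offS szL er; lia.
    by rewrite nilr.
  by move=> a; rewrite h2 szL er addn1.
exists d'.+1; first by rewrite ltnS.
exists (rcons l u), r; split; split=> //.
- by rewrite cat_rcons.
- by rewrite size_rcons /=; lia.
- by move=> a; rewrite size_rcons h2.
by rewrite size_rcons; apply: leq_trans t2 _; lia.
Qed.

Definition code (o : option (option 'I_n)) : nat :=
  match o with None => 0 | Some None => n.+1 | Some (Some p) => p.+1 end.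

Definition mark_mem (h : nat -> nat) (m : marking 'I_n) :=
  forall v : 'I_n, h (20 + n + v) = code (m v).

(** The head of the list is the top of the stack, at the highest address; hence the reversal. *)
Definition stack_mem (h : nat -> nat) (s : seq 'I_n) :=
  forall i, i < size s -> h (20 + 2 * n + i) = nth 0 (rev [seq val u | u <- s]) i.

Lemma wp_read_graph Q s : 0 < n -> reg s rO = 1 -> reg s rN = n ->
  inp s = flatten [seq block v | v <- enum 'I_n] -> (forall a, heap s a = 0) ->
  (forall s1, [/\ base s1, adj_mem (heap s1), mark_mem (heap s1) [ffun=> None],
       stack_mem (heap s1) (rev (enum 'I_n)) & reg s1 rS = 20 + 3 * n] ->
     out s1 = out s -> tm s1 <= tm s + 20 * off n -> Q s1) ->
  wp B read_graph Q s.
Proof.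
move=> n_gt0 eO eN eI h0 hQ; have bn := offn; have b0 := off0.
rewrite /read_graph; apply: wp_seq; sym_exec; rewrite eN.
do 7?[split; first by lia].
(* The time is charged to the adjacency cells filled so far, [off k - off 0] of them, at 20
   instructions each; 7 is the start-up. *)
pose I d s1 := exists k, [/\ d = n - k, k < n, base s1, reg s1 rV = k & reg s1 rA = off k] /\
  [/\ reg s1 rS = 20 + 2 * n + k, out s1 = out s,
     inp s1 = flatten [seq block v | v <- drop k (enum 'I_n)],
     forall a, 20 + n <= a < 20 + 2 * n -> heap s1 a = 0 &
     forall v : 'I_n, v < k -> [/\ heap s1 (20 + v) = off v, heap s1 (off v) = size (L v),
      (forall i, i < size (L v) -> heap s1 (off v + i.+1) = nth 0 [seq val u | u <- L v] i) &
      heap s1 (20 + 2 * n + v) = v]] /\ tm s1 + 20 * off 0 <= tm s + 7 + 20 * off k.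
apply: (@wp_rep _ _ _ I _ n); last first.
  exists 0; split; [split=> // | split; first split=> //]; rewrite /=; try lia.
  - by split; rewrite /=; lia.
  - by rewrite drop0.
  - by move=> a _; apply: h0.
move=> d s1 [k [[-> lt_k [b1 b2 b3 b4 b5] eV eA] [[eS eo ei hm hv] tm1]]].
pose v := Ordinal lt_k.
have eI1 : inp s1 = size (L v) :: [seq val u | u <- L v] ++
    flatten [seq block w | w <- drop k.+1 (enum 'I_n)].
  rewrite ei (drop_nth v) ?size_enum_ord //= (_ : nth _ _ _ = v) //.
  by apply: val_inj; rewrite /= nth_enum_ord.
have [bv1 bv2] := off_bounds v; rewrite /= in bv1 bv2.
apply: wp_seq; sym_exec; rewrite b3 eV b1 eS eA eI1 /=.
do 7?[split; first by lia].
apply: wp_seq; set s2 := (X in wp _ _ _ X).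
apply: (@wp_read_block v (flatten [seq block w | w <- drop k.+1 (enum 'I_n)])); rewrite /s2 //=.
  by rewrite addn1.
move=> s3 [eA3 ei3 eo3 er3] eh3 tm3.
have [e1 e2] : reg s3 rO = 1 /\ reg s3 rV = k by rewrite !er3.
have e3 : reg s3 rN = n by rewrite er3.
sym_exec; rewrite e1 e2 e3.
split; first by lia.
split=> //; set s4 := tick _.
have hlow a : a <= off k -> heap s4 a = if a == off k then size (L v) else
   if a == 20 + 2 * n + k then k else if a == 20 + k then off k else heap s1 a.
  move=> le_a; rewrite /= eh3 ifN; last by rewrite /=; lia.
  by rewrite -!eqnE.
have ih (w : 'I_n) : w < k.+1 -> [/\ heap s4 (20 + w) = off w, heap s4 (off w) = size (L w),
      (forall i, i < size (L w) -> heap s4 (off w + i.+1) = nth 0 [seq val u | u <- L w] i) &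
      heap s4 (20 + 2 * n + w) = w].
  rewrite ltnS leq_eqVlt => /orP[/eqP eqw|lt_w].
    have -> : w = v by apply: val_inj.
    split=> [|||].
    - rewrite hlow; last by rewrite /=; lia.
      by repeat (rewrite ifN; last by rewrite /=; lia); rewrite eqxx.
    - by rewrite hlow //= eqxx.
    - by move=> i lt_i; rewrite /= eh3 /= ifT ?addnS ?subSS ?addKn //; lia.
    rewrite hlow; last by rewrite /=; lia.
    by repeat (rewrite ifN; last by rewrite /=; lia); rewrite eqxx.
  have [h1 h2 h3 h4] := hv w lt_w; have := leq_off lt_w; rewrite offS => le_w.
  have := leq_off (leq0n w); rewrite off0 => le_0.
  split=> [||i lt_i|].
  - rewrite hlow; last by lia.
    by repeat (rewrite ifN; last by lia).
  - rewrite hlow; last by lia.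
    by repeat (rewrite ifN; last by lia).
  - rewrite hlow; last by lia.
    by repeat (rewrite ifN; last by lia); apply: h3.
  rewrite hlow; last by lia.
  by repeat (rewrite ifN; last by lia).
(* The mark cells are never written here, and the initial content 0 is the code of [None]. *)
have hm4 a : 20 + n <= a < 20 + 2 * n -> heap s4 a = 0.
  move=> ha; rewrite hlow; last by lia.
  by repeat (rewrite ifN; last by lia); apply: hm.
have base4 : base s4.
  by split; rewrite /s4 /= er3 //.
have eS4 : reg s4 rS = 20 + 2 * n + k.+1.
  by rewrite /s4 /= er3 //=; lia.
have t4 : tm s4 + 20 * off 0 <= tm s + 7 + 20 * off k.+1.
  by move: tm3; rewrite /= -[k.+1]/((v : nat).+1) offS /=; lia.
have eA4 : reg s4 rA = off k.+1 by rewrite /s4 /= eA3.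
case ek: (n - (k + 1)) => [|d'].
  have {}ek : n = k.+1 by lia.
  apply: hQ.
  - split=> //.
    + by move=> w; have [|//] := ih w; first by have := ltn_ord w; lia.
    + by move=> w; rewrite ffunE hm4 //; have := ltn_ord w; lia.
    + move=> i; rewrite size_rev size_enum_ord => lt_i.
      rewrite map_rev revK val_enum_ord nth_iota // add0n.
      by have [|_ _ _ /=] := ih (Ordinal lt_i); first by rewrite /=; lia.
    + by rewrite eS4; lia.
  - by rewrite /= eo3.
  - by move: t4; rewrite -ek; lia.
exists (n - k.+1); first by lia.
exists k.+1; split.
  by split=> //; first lia; rewrite /s4 /= addn1.
by split=> //; split=> //=; rewrite ?eo3 ?ei3.
Qed.


(* Every vertex is pushed once initially and once when it is marked: marking u
   moves w u from the second sum to the first. *)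
Definition weight (w : 'I_n -> nat) (st : marking 'I_n * seq 'I_n) :=
  \sum_(y <- st.2) w y + \sum_(y | st.1 y == None) w y.

Lemma weight_init w : weight w ([ffun=> None], rev (enum 'I_n)) = 2 * \sum_v w v.
Proof.
rewrite mul2n -addnn /weight /= (perm_big (enum 'I_n)) ?perm_rev // big_enum /=.
by congr addn; apply: eq_bigl => y; rewrite ?ffunE.
Qed.

Lemma weight_mark w (m : marking 'I_n) s x o : m x = None ->
  weight w (m, s) = weight w (mark m x o, s) + w x.
Proof.
move=> mx; rewrite /weight /= -addnA; congr addn.
rewrite (bigD1 x) ?mx //= addnC; congr addn; apply: eq_bigl => y; rewrite ffunE.
by case: (y =P x) => [->|_]; rewrite ?mx ?andbT.
Qed.

Lemma weight_cons w (m : marking 'I_n) s x : weight w (m, x :: s) = weight w (m, s) + w x.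
Proof. by rewrite /weight /= big_cons -addnA addnC. Qed.

Lemma weight_visits w x l st : weight w (foldl (visit x) st l) = weight w st.
Proof.
elim: l st => //= u l IH [m s]; rewrite IH /visit /=.
by case mu: (m u) => [o|] //=; rewrite weight_cons -weight_mark.
Qed.

(** Weight is lost only when [x] becomes a root: it then leaves the unmarked sum without being
    pushed. *)
Lemma weight_explore w (m : marking 'I_n) s x : weight w (explore L m x s) <= weight w (m, s).
Proof.
rewrite weight_visits /mark_root; case mx: (m x) => [o|] //.
by rewrite (weight_mark w s None mx) leq_addr.
Qed.

Definition search_mem (s : cfg) (st : marking 'I_n * seq 'I_n) :=
  [/\ adj_mem (heap s), mark_mem (heap s) st.1, stack_mem (heap s) st.2 &
      reg s rS = 20 + 2 * n + size st.2].

Lemma mark_mem_upd h m (x : 'I_n) o : mark_mem h m ->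
  mark_mem (upd_heap h (20 + n + x) (code (Some o))) (mark m x o).
Proof.
move=> hm v; rewrite upd_heapE ffunE eqn_add2l -[_ == _ :> nat]/(v == x).
by case: eqP.
Qed.

Lemma mark_mem_stack h m a x : 20 + 2 * n <= a -> mark_mem h m ->
  mark_mem (upd_heap h a x) m.
Proof. by move=> ha hm v; rewrite upd_heapE ifN ?hm //; have := ltn_ord v; lia. Qed.

Lemma stack_mem_mark h s a x : a < 20 + 2 * n -> stack_mem h s ->
  stack_mem (upd_heap h a x) s.
Proof. by move=> ha hs i lt_i; rewrite upd_heapE ifN ?hs //; lia. Qed.

Lemma stack_mem_push h s (u : 'I_n) : stack_mem h s ->
  stack_mem (upd_heap h (20 + 2 * n + size s) u) (u :: s).
Proof.
move=> hs i; rewrite /= ltnS => le_i; rewrite upd_heapE rev_cons nth_rcons.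
rewrite size_rev size_map eqn_add2l; case: ltngtP le_i => // lt_i _; exact: hs.
Qed.

Lemma stack_mem_pop h s (u : 'I_n) : stack_mem h (u :: s) ->
  h (20 + 2 * n + size s) = u /\ stack_mem h s.
Proof.
move=> hs; split.
  by rewrite hs //= rev_cons nth_rcons size_rev size_map ltnn eqxx.
move=> i lt_i; rewrite hs; last by rewrite /= ltnS ltnW.
by rewrite /= rev_cons nth_rcons size_rev size_map lt_i.
Qed.

(** The unmarked [u] still carries one unit of weight outside the stack, so a cell is free for
    pushing it. *)
Lemma size_stack_lt (m : marking 'I_n) s u : weight (fun=> 1) (m, s) <= 2 * n -> m u = None ->
  size s < 2 * n.
Proof.
move=> + mu; rewrite (weight_mark _ _ None mu) /weight /= sum1_size; lia.
Qed.

Lemma wp_visit_body (x u : 'I_n) (st : marking 'I_n * seq 'I_n) s (Q : cfg -> Prop) :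
  base s -> search_mem s st -> reg s rX = x.+1 -> reg s rU = u ->
  weight (fun=> 1) st <= 2 * n ->
  (forall s1, base s1 -> search_mem s1 (visit x st u) -> out s1 = out s ->
    reg s1 rV = reg s rV -> reg s1 rX = reg s rX -> reg s1 rA = reg s rA -> reg s1 rD = reg s rD ->
    tm s1 <= tm s + 6 -> Q s1) ->
  wp B visit_body Q s.
Proof.
case: st => m stk [b1 b2 b3 b4 b5] [/= hA hM hS eS] eX eU hw hQ.
have bn := offn; have b0 := off0; have lt_u := ltn_ord u; have lt_x := ltn_ord x.
rewrite /visit_body; sym_exec; rewrite b4 eU hM.
split; first by lia.
split; first by lia.
case mu: (m u) => [o|] /=.
  by case: o mu => [p|] mu /=; apply: hQ => //=; try lia; rewrite /visit /= mu.
have lt_s := size_stack_lt hw mu.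
split; first by lia.
split; first by lia.
split; first by lia.
apply: hQ => //=; try lia; rewrite /visit /= mu eX eS.
split=> /=.
- by do 2?[apply: adj_mem_upd; first by lia].
- by apply: mark_mem_stack; [lia | apply: mark_mem_upd (Some x) hM].
- by apply: stack_mem_push; apply: stack_mem_mark; first lia.
by lia.
Qed.

Lemma wp_search Q s : 0 < n -> base s -> out s = [::] ->
  search_mem s ([ffun=> None], rev (enum 'I_n)) ->
  (forall s1 m, base s1 -> adj_mem (heap s1) -> mark_mem (heap s1) m -> finished G m ->
    out s1 = [::] -> tm s1 <= tm s + 60 * off n -> Q s1) ->
  wp B search Q s.
Proof.
move=> n_gt0 bs os ms hQ; have bn := offn; have b0 := off0.
(* The weight of a vertex pays for one exploration: 10 per neighbour, of which 6 for the visit and 4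
   for the loop, and at most 20 for the rest. *)
pose w (v : 'I_n) := 20 + 10 * size (L v).
have ew : weight w ([ffun=> None], rev (enum 'I_n)) <= 40 * off n.
  rewrite weight_init /w big_split /= sum_nat_const card_ord -big_distrr /=.
  by rewrite -[X in 10 * X]/(\sum_u size (L u)) bn; lia.
have ew1 : weight (fun=> 1) ([ffun=> None], rev (enum 'I_n)) <= 2 * n.
  by rewrite weight_init sum_nat_const card_ord muln1.
(* The remaining weight is both the variant of the loop and its remaining time budget, while unit
   weights keep the stack within its [2 * n] cells. *)
pose I d s1 := exists m stk E, [/\ base s1, out s1 = [::], search_mem s1 (m, stk),
    search_inv G E m stk & weight (fun=> 1) (m, stk) <= 2 * n] /\
  [/\ stk <> [::], d = weight w (m, stk) &
      tm s1 + d <= tm s + weight w ([ffun=> None], rev (enum 'I_n))].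
rewrite /search; apply: (@wp_rep _ _ _ I _ (weight w ([ffun=> None], rev (enum 'I_n)))); last first.
  exists [ffun=> None], (rev (enum 'I_n)), set0; split; split=> //.
    by apply: search_inv_init => y; rewrite mem_rev mem_enum.
  by move/(congr1 size); rewrite size_rev size_enum_ord /=; lia.
move=> d s1 [m [[|x stk] [E [[[b1 b2 b3 b4 b5] os1 [/= hA hM hS eS] inv hw] [// _ ed tm1]]]]].
have ewx : w x = 20 + 10 * size (L x) by [].
have [hx hS'] := stack_mem_pop hS; have lt_x := ltn_ord x.
have hw' : weight (fun=> 1) (m, stk) <= 2 * n by apply: leq_trans hw; rewrite weight_cons; lia.
have lt_stk : size stk <= 2 * n.
  by apply: leq_trans hw'; rewrite /weight /= sum1_size leq_addr.
have eP : 20 + 2 * n + (size stk).+1 - 1 = 20 + 2 * n + size stk by lia.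
apply: wp_seq; sym_exec; rewrite b1 b2 b4 eS eP hx hM.
split; first by lia.
split; first by lia.
split; first by lia.
split; first by lia.
pose J l s2 := [/\ base s2, search_mem s2 (foldl (visit x) (mark_root m x, stk) l),
    reg s2 rV = x, reg s2 rX = x.+1 & out s2 = [::]].
(* From here on the round is the same whether [x] was a child, a root or unmarked. *)
have loop s2 : J [::] s2 -> tm s2 <= tm s1 + 8 ->
   wp B (for_neighbors visit_body;; ISub rT rS rK)
    (fun s' => if reg s' 0 is 0 then Q (tick s') else exists2 k' : nat, k' < d & I k' (tick s')) s2.
  move=> J0 tm2; apply: wp_seq; apply: (@wp_for_neighbors x visit_body 6 J) => //.
  - move=> l s3 s4 [e1 e2 e3 e4] [[c1 c2 c3 c4 c5] [d1 d2 d3 d4] f1 f2 f3].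
    by split; rewrite ?e3 ?e4 //; split; rewrite ?e1 ?e4.
  - by move=> l s3 [[c1 c2 c3 c4 c5] [d1 d2 d3 d4] f1 f2 f3].
  - move=> l u r s3 _ [c d' f1 f2 f3] eU.
    apply: (wp_visit_body c d' f2 eU).
      rewrite weight_visits; apply: leq_trans hw'.
      rewrite /mark_root; case mx: (m x) => [o|] //.
      by rewrite (weight_mark _ _ None mx) leq_addr.
    move=> s4 h1 h2 h3 h4 h5 h6 h7 h8; split=> //; split=> //; rewrite ?foldl_rcons ?h3 ?h4 ?h5 //.
  move=> s3 [c [d1 d2 d3 d4] f1 f2 f3] tm3.
  have [c1 c2 c3 c4 c5] := c.
  rewrite -[foldl _ _ _]/(explore L m x stk) in d2 d3 d4.
  have := search_inv_step adjL inv; have := weight_explore w m stk x.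
  have := weight_explore (fun=> 1) m stk x.
  case: (explore L m x stk) d2 d3 d4 => m2 stk2 /= d2 d3 d4 hw1 hww inv2.
  sym_exec; rewrite d4 c5 addKn; split=> //.
  have {}hww : weight w (m2, stk2) <= weight w (m, stk) := hww.
  have {}hw1 : weight (fun=> 1) (m2, stk2) <= weight (fun=> 1) (m, stk) := hw1.
  have {}tm3 : tm s3 <= tm s2 + 6 + (6 + 4) * size (L x) := tm3.
  have tm4 : (tm s3).+2 + weight w (m2, stk2) <= tm s + weight w ([ffun=> None], rev (enum 'I_n)).
    move: hww ed tm1 tm2 tm3; rewrite weight_cons ewx => + ->.
    by move: (weight _ _) (weight _ _) (weight _ _) (size _) => a b c' e; lia.
  case es: (size stk2) => [|k].
    rewrite (size0nil es) in inv2 *.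
    apply: (hQ _ m2) => //=; first by exists (x |: E).
    lia.
  exists (weight w (m2, stk2)).
    move: hww ed; rewrite weight_cons ewx => + ->.
    by move: (weight _ _) (weight _ _) => a b; lia.
  exists m2, stk2, (x |: E); split; split=> //; first by apply: leq_trans hw'.
  by move=> h; rewrite h in es.
case mx: (m x) => [[p|]|] /=; (split; first by lia).
- split; first by lia.
  apply: loop => /=; last by lia.
  by rewrite /J /mark_root mx; split=> //=; lia.
- split; first by lia.
  apply: loop => /=; last by lia.
  by rewrite /J /mark_root mx; split=> //=; lia.
split; first by lia.
split; first by lia.
apply: loop => /=; last by lia.
rewrite /J /mark_root mx; split=> //=; last by rewrite addn1.
split=> //=.
- by apply: adj_mem_upd; first lia.
- by rewrite addn1; apply: mark_mem_upd None hM.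
- by apply: stack_mem_mark; first lia.
Qed.


Lemma code_le (o : option (option 'I_n)) : code o <= n.+1.
Proof. by case: o => [[p|]|] //=; rewrite ltnW // ltnS. Qed.

(** Children have codes from 1 to [n], so [n.+1] is free for roots, and the machine may compare
    codes instead of marks. *)
Lemma code_inj : injective code.
Proof.
by case=> [[p|]|] [[q|]|] //= [e]; rewrite ?(val_inj e) //;
  [have := ltn_ord p | have := ltn_ord q]; lia.
Qed.

Lemma wp_test_clique (m : marking 'I_n) (v u : 'I_n) Q s :
  base s -> mark_mem (heap s) m -> reg s rX = code (m v) -> reg s rU = u ->
  (forall s1, (forall r, r \notin [:: rT; rE; rY] -> reg s1 r = reg s r) ->
     heap s1 = heap s -> out s1 = out s -> (reg s1 rE == 0) = same_clique m v u ->
     tm s1 <= tm s + 11 -> Q s1) ->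
  wp B test_clique Q s.
Proof.
move=> [b1 b2 b3 b4 b5] hM eX eU hQ; have bn := offn; have lt_u := ltn_ord u.
have le_u := code_le (m u); have le_v := code_le (m v).
have e1 : (m u == m v) = (code (m u) == code (m v)) by rewrite (inj_eq code_inj).
have e2 : (m v == Some (Some u)) = (code (m v) == u.+1) by rewrite -(inj_eq code_inj).
rewrite /test_clique; sym_exec; rewrite b1 b4 eX eU hM.
split; first by lia.
split; first by lia.
split=> //; split=> //.
split; first by lia.
split; first by lia.
split=> //; split=> //.
split; first by lia.
set t := _ + _; case et: t => [|k]; rewrite /t in et.
  split; first by lia.
  apply: hQ => //=; last by lia.
    by move=> r; rewrite !inE !negb_or => /and3P[/negPf r1 /negPf r2 /negPf r3];
      rewrite /= !eqnE r1 r2 r3.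
  by rewrite /same_clique e2; symmetry; apply/orP; right; lia.
apply: hQ => //=; last by lia.
  by move=> r; rewrite !inE !negb_or => /and3P[/negPf r1 /negPf r2 /negPf r3];
    rewrite /= !eqnE r1 r2 r3.
have /negPf ne : code (m v) != u.+1 by lia.
rewrite /same_clique e1 e2 ne orbF.
by move: (code _) (code _) => a b; apply/eqP/eqP; lia.
Qed.

Lemma wp_count_cliques (m : marking 'I_n) Q s : 0 < n -> base s -> adj_mem (heap s) ->
  mark_mem (heap s) m -> out s = [::] ->
  (forall s1 (w : 'I_n), base s1 -> adj_mem (heap s1) -> mark_mem (heap s1) m ->
     out s1 = [::] -> reg s1 rW = w ->
     (forall u, count (same_clique m u) (L u) <= count (same_clique m w) (L w)) ->
     tm s1 <= tm s + 30 * off n -> Q s1) ->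
  wp B count_cliques Q s.
Proof.
move=> n_gt0 [b1 b2 b3 b4 b5] hA hM os hQ; have bn := offn; have b0 := off0.
pose cnt v := count (same_clique m v) (L v).
rewrite /count_cliques; apply: wp_seq; sym_exec.
do 3?[split; first by lia].
(* Before the first round [w] is a mere placeholder with [b = 0]; since ties replace it, [b] is the
   count of [w] from the first round on. *)
pose I d s1 := exists k b (w : 'I_n), [/\ base s1, adj_mem (heap s1), mark_mem (heap s1) m,
    out s1 = [::] & [/\ d = n - k, k < n, reg s1 rV = k, reg s1 rB = b & reg s1 rW = w]] /\
  [/\ forall u : 'I_n, u < k -> cnt u <= b, (if k is 0 then b = 0 else b = cnt w), b <= off n &
      tm s1 + 25 * off 0 <= tm s + 3 + 25 * off k].
apply: (@wp_rep _ _ _ I _ n); last first.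
  exists 0, 0, (Ordinal n_gt0); split; first by split=> //; split=> //=; rewrite subn0.
  by split=> //=; lia.
move=> d s1 [k [b [w [[[c1 c2 c3 c4 c5] hA1 hM1 os1 [-> lt_k eV eB eW]] [hle heq le_b tm1]]]]].
pose v := Ordinal lt_k; have vE : k = v by [].
have [bv1 bv2] := off_bounds v; rewrite /= in bv1 bv2.
have offk := offS v; rewrite /= in offk.
have lt_w := ltn_ord w; have le_c := count_size (same_clique m v) (L v).
apply: wp_seq; sym_exec; rewrite c4 eV.
split; first by lia.
split; first by lia.
split; first by lia.
apply: wp_seq; set s2 := (X in wp _ _ _ X).
pose J l s3 := [/\ base s3, adj_mem (heap s3), mark_mem (heap s3) m, out s3 = [::] &
   [/\ reg s3 rV = v, reg s3 rX = code (m v), reg s3 rC = count (same_clique m v) l,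
      reg s3 rB = b & reg s3 rW = w]].
apply: (@wp_for_neighbors v count_body 13 J) => //.
- move=> l s3 s4 [f1 f2 f3 f4] [[g1 g2 g3 g4 g5] g6 g7 g8 [g9 g10 g11 g12 g13]].
  by split; rewrite ?f1 ?f3 //; split; rewrite ?f4.
- by move=> l s3 [[g1 g2 g3 g4 g5] g6 g7 g8 [g9 g10 g11 g12 g13]].
- move=> l u r s3 eL [g g6 g7 g8 [g9 g10 g11 g12 g13]] eU; have [g1 g2 g3 g4 g5] := g.
  rewrite /count_body; apply: wp_seq; apply: (wp_test_clique g g7 g10 eU).
  move=> s4 fr eh eo ec tm4; sym_exec.
  have cr : count (same_clique m v) (rcons l u) = count (same_clique m v) l + same_clique m v u.
    by rewrite -cats1 count_cat /= addn0.
  have le_l : (count (same_clique m v) l).+1 <= size (L v).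
    by rewrite eL size_cat /= addnS ltnS; apply: leq_trans (count_size _ _) (leq_addr _ _).
  rewrite /J cr -ec; case e: (reg s4 12) => [|j] /=.
    rewrite !fr // g11 g1; split; first by lia.
    split=> //; last by lia.
    by split; rewrite ?eh ?eo //; split; rewrite /= ?fr.
  split; rewrite ?fr //; last by lia.
  by split; rewrite ?eh ?eo //; split; rewrite /= ?fr // addn0.
- by split=> //; rewrite /s2 /= vE.
move=> s3 [[g1 g2 g3 g4 g5] g6 g7 g8 [g9 g10 g11 g12 g13]] tm3.
have {}tm3 : tm s3 <= (tm s1).+3 + 6 + 17 * size (L v) := tm3.
sym_exec; rewrite g11 g12 g9 g1 g2.
have le_all b' : b <= b' -> cnt v <= b' -> forall u : 'I_n, u < k.+1 -> cnt u <= b'.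
  move=> h1 h2 u; rewrite ltnS leq_eqVlt => /orP[/eqP e|/hle h]; last exact: leq_trans h h1.
  by rewrite (_ : u = v) //; apply: val_inj.
have step b' (w' : 'I_n) s4 : b <= b' -> cnt v <= b' -> b' = cnt w' -> b' <= off n ->
   heap s4 = heap s3 -> out s4 = [::] -> base s4 -> reg s4 rV = v + 1 ->
   reg s4 rB = b' -> reg s4 rW = w' ->
   tm s4 <= tm s3 + 8 ->
   match n - (v + 1) with 0 => Q s4 | _.+1 => exists2 k', k' < n - k & I k' s4 end.
  move=> h1 h2 h3 h4 h5 h6 h7 h8 h9 h10 h11.
  have tm4 : tm s4 + 25 * off 0 <= tm s + 3 + 25 * off k.+1 by rewrite offk; lia.
  case ek: (n - (v + 1)) => [|j].
    have {}ek : n = k.+1 by move: ek; rewrite -vE; lia.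
    apply: (hQ _ w') => //; rewrite ?h5 //; last by rewrite -ek in tm4; lia.
    by move=> u; rewrite -[leqRHS]/(cnt w') -h3; apply: le_all => //; rewrite -ek.
  have lt_k1 : k.+1 < n by move: ek; rewrite -vE; lia.
  exists (n - k.+1); first by lia.
  exists k.+1, b', w'; split; split; rewrite ?h5 //; first by split; rewrite ?h8 ?addn1.
  exact: le_all.
have {}le_c : cnt v <= size (L v) := le_c.
rewrite -/(cnt v); case eb: (b - cnt v) => [|j].
  split; first by lia.
  split; first by lia.
  split; first by lia.
  split; first by lia.
  split; first by lia.
  split=> //; apply: (step (cnt v) v) => //=; try lia.
split; first by lia.
split; first by lia.
split=> //; apply: (step b w) => //=; try lia.
by case: (k) heq => [|//] b_eq0; rewrite b_eq0 in eb.
Qed.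


Lemma wp_write_clique (m : marking 'I_n) (w : 'I_n) Q s : base s -> adj_mem (heap s) ->
  mark_mem (heap s) m -> out s = [::] -> reg s rW = w ->
  (forall s1, out s1 = [seq val u | u <- w :: filter (same_clique m w) (L w)] ->
     tm s1 <= tm s + 20 * off n -> Q s1) ->
  wp B write_clique Q s.
Proof.
move=> [b1 b2 b3 b4 b5] hA hM os eW hQ; have lt_w := ltn_ord w; have bn := offn.
have b0 := off0; have [bw1 bw2] := off_bounds w; have offw := offS w.
rewrite /write_clique; apply: wp_seq; sym_exec; rewrite eW b4 os.
do 3?[split; first by lia].
split; first by lia.
split; first by lia.
pose J l s2 := [/\ base s2, adj_mem (heap s2), mark_mem (heap s2) m,
    reg s2 rV = w /\ reg s2 rX = code (m w) &
    out s2 = [seq val u | u <- w :: filter (same_clique m w) l]].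
set s1 := (X in wp _ _ _ X).
apply: (@wp_for_neighbors w write_body 13 J) => //.
- move=> l s2 s3 [f1 f2 f3 f4] [[g1 g2 g3 g4 g5] g6 g7 [g8 g9] g10].
  by split; rewrite ?f1 ?f3 //; split; rewrite ?f4.
- by move=> l s2 [[g1 g2 g3 g4 g5] g6 g7 [g8 g9] g10].
- move=> l u r s2 eL [g g6 g7 [g8 g9] g10] eU; have [g1 g2 g3 g4 g5] := g.
  rewrite /write_body; apply: wp_seq; apply: (wp_test_clique g g7 g9 eU).
  move=> s3 fr eh eo ec tm3; sym_exec.
  rewrite /J filter_rcons -ec; case e: (reg s3 12) => [|j] /=.
    split=> //; split; rewrite /= ?fr //; last by lia.
    split; rewrite ?eh //=; last by rewrite eo g10 map_rcons eU.
    by split; rewrite /= fr.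
  split; rewrite /= ?fr //; last by lia.
  split; rewrite ?eh ?eo ?fr //.
  by split; rewrite /= fr.
- by rewrite /J /s1 /= !addn0 hM.
move=> s2 [_ _ _ _ eo] tm2; apply: hQ => //.
have {}tm2 : tm s2 <= (tm s).+4.+1 + 6 + 17 * size (L w) := tm2.
by have := leq_off (ltn_ord w); rewrite offw; lia.
Qed.

Hypothesis hG : no_cycle_with_unique_chord G.

(** The factor 150 exceeds the sum 20 + 60 + 30 + 20 of the phase budgets and absorbs the start-up
    instructions. *)
Lemma wp_clique_cmd :
  wp B clique_cmd (fun s => tm s <= 150 * off n /\
      exists2 K : {set 'I_n}, maximum_clique G K & lists_set (out s) K)
    (Cfg (fun=> 0) (fun=> 0) (encode L) [::] 0).
Proof.
have bn := offn; have b0 := off0.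
rewrite /clique_cmd; apply: wp_seq; sym_exec.
have -> : head 0 (encode L) = n by [].
split; first by lia.
split; first by lia.
apply: wp_seq; sym_exec; split=> //; apply: wp_unless => /=.
(* Without vertices the guard skips all phases, and the empty output lists the empty clique. *)
case: (posnP n) => [n0|n_gt0].
  rewrite {1}n0 /=; split; first by lia.
  have no_vertex (v : 'I_n) : False by have := ltn_ord v; lia.
  exists set0; last by rewrite /lists_set enum_set0.
  split=> [x|K _]; first by case: (no_vertex x).
  by rewrite cards0 leqn0 cards_eq0; apply/eqP/setP=> v; case: (no_vertex v).
have -> : 1 - n = 0 by lia.
apply: wp_seq; apply: wp_read_graph => // s1 [bs1 am1 mm1 sm1 eS1] os1 tm1.
have {}tm1 : tm s1 <= 4 + 20 * off n := tm1.
apply: wp_seq; apply: wp_search => //.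
  by split=> //; rewrite eS1 size_rev size_enum_ord; lia.
move=> s2 m bs2 am2 mm2 fin os2 tm2.
apply: wp_seq; apply: (wp_count_cliques n_gt0 bs2 am2 mm2 os2).
move=> s3 w bs3 am3 mm3 os3 eW hw tm3.
apply: (wp_write_clique bs3 am3 mm3 os3 eW) => s4 os4 tm4; split; first by lia.
exists (clique_at L m w); last first.
  by rewrite /lists_set os4; apply: perm_map; apply: (perm_clique_at adjL).
by apply: (clique_at_maximum hG adjL fin) => u; rewrite !(card_clique_at adjL) ltnS.
Qed.

End Program.

Theorem theorem7p1 :
  exists P : program,
    linear_time_algorithm P
      (fun n (G : sgraph 'I_n) => no_cycle_with_unique_chord G)
      (fun n (G : sgraph 'I_n) r =>
         exists2 K : {set 'I_n}, maximum_clique G K & lists_set r K).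
Proof.
(* Here 3000 is 150 * 20, from the time bound [150 * off n] and [off n <= 20 * N.+1]. The sigma type
   hides the numeral, so that [N.+2 ^ c] is not computed. *)
have [c ec] : {c | c = 3000} by exists 3000.
exists (compile 0 clique_cmd), c => n G L hG adjL N.
have le_off : off L n <= 20 * N.+1.
  by have := sum_degrees_le adjL; rewrite offn /N; lia.
have leB : off L n <= N.+2 ^ c.
  (* As [20 * N.+1] is at most [2 ^ 5 * N.+2], the exponent 6 suffices. *)
  apply: leq_trans le_off _; apply: leq_trans (_ : N.+2 ^ 6 <= _); last first.
    by apply: leq_pexp2l => //; rewrite ec.
  have h5 : 2 ^ 5 <= N.+2 ^ 5 by rewrite leq_exp2r.
  by rewrite expnS; nia.
apply: wp_computes => //; apply: wp_conseq (wp_clique_cmd adjL leB hG) => s [le_tm hs].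
by split=> //; apply: leq_trans le_tm _; rewrite ec; lia.
Qed.
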